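(* Let $A$ be a $\mathbb Z$-superalgebra which is free of finite rank over $\mathbb Z$, let $d\ge 0$, $n\ge1$ with $d\le n$, and let $D^A(n,d)\subseteq{}'D^A(n,d)$ be the Schur double and its divided power version (defined in the context). Let $C$ be a subalgebra of ${}'D^A(n,d)$ such that $D^A(n,d)\subseteq C\subseteq{}'D^A(n,d)$. Suppose that for every prime $p$ the $\mathbb F_p$-algebra $C\otimes_{\mathbb Z}\mathbb F_p$ is symmetric. Then $C=D^A(n,d)$.
   Context: A finite-dimensional algebra over a field is symmetric if it admits a non-degenerate symmetric associative bilinear form (associative: $(xy,z)=(x,yz)$). Super conventions. $\mathbb Z_2=\{\bar0,\bar1\}$; $R$ denotes a base ring ($\mathbb Z$ or $\mathbb Q$ here). An $R$-superspace is $V=V_{\bar0}\oplus V_{\bar1}$ with both summands free of finite rank over $R$; $\bar v$ is the parity of a homogeneous $v$; formulas with parities are for homogeneous elements, extended linearly. Superalgebras are associative, unital, with parity-compatible product. $V^*=\mathrm{Hom}_R(V,R)$ with its natural $\mathbb Z_2$-grading and $\langle v,\beta\rangle=\langle\beta,v\rangle=\beta(v)$. Put $[u_1,\dots,u_d;w_1,\dots,w_d]=\sum_{1\le a<c\le d}\bar u_c\bar w_a$. Identify $(V_1\otimes\cdots\otimes V_d)^*$ with $V_1^*\otimes\cdots\otimes V_d^*$ by $\langle\beta_1\otimes\cdots\otimes\beta_d,v_1\otimes\cdots\otimes v_d\rangle=(-1)^{[\beta_1,\dots,\beta_d;v_1,\dots,v_d]}\prod_a\langle\beta_a,v_a\rangle$.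 A tensor product of superalgebras is a superalgebra via $(v_1\otimes\cdots\otimes v_d)(w_1\otimes\cdots\otimes w_d)=(-1)^{[v_1,\dots,v_d;w_1,\dots,w_d]}v_1w_1\otimes\cdots\otimes v_dw_d$. The symmetric group $\mathfrak S_d$ acts on the right on $V^{\otimes d}$ by $(v_1\otimes\cdots\otimes v_d)^g=(-1)^{m}v_{g1}\otimes\cdots\otimes v_{gd}$, $m=\sum_{a<c,\ g^{-1}a>g^{-1}c}\bar v_a\bar v_c$. Invariants. $\mathrm{Inv}^dV=(V^{\otimes d})^{\mathfrak S_d}$, $\mathrm{Inv}\,V=\bigoplus_{d\ge0}\mathrm{Inv}^dV$. The coproduct $\Delta(v_1\otimes\cdots\otimes v_d)=\sum_{e=0}^d(v_1\otimes\cdots\otimes v_e)\otimes(v_{e+1}\otimes\cdots\otimes v_d)$ restricts to $\mathrm{Inv}\,V\to\mathrm{Inv}\,V\otimes\mathrm{Inv}\,V$; write $\Delta(\xi)=\sum\xi_{(1)}\otimes\xi_{(2)}$. For a superalgebra $X$, $\mathrm{Inv}^dX$ is a subsuperalgebra of $X^{\otimes d}$, and $\mathrm{Inv}\,X$ carries the product which is this one on each $\mathrm{Inv}^dX$ and zero between different $d$. Doubles. Let $X$ be a superalgebra, free of finite rank. $(\mathrm{Inv}\,X)^*=\bigoplus_d(\mathrm{Inv}^dX)^*$ is a superalgebra with $\langle xy,\xi\rangle=\langle x\otimes y,\Delta(\xi)\rangle$, and an $\mathrm{Inv}\,X$-bimodule by $\langle x\cdot\xi,\eta\rangle=\langle x,\xi\eta\rangle$,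 $\langle\eta,\xi\cdot x\rangle=\langle\eta\xi,x\rangle$ (actions of $\mathrm{Inv}^dX$ on $(\mathrm{Inv}^eX)^*$ being zero for $d\ne e$). The Turner double is $DX=\mathrm{Inv}\,X\otimes(\mathrm{Inv}\,X)^*$ with product $$(\xi\otimes x)(\eta\otimes y)=\sum(-1)^{\bar\xi_{(1)}(\bar\xi_{(2)}+\bar\eta+\bar x)+\bar\eta_{(1)}\bar x}\,\xi_{(2)}\eta_{(1)}\otimes(x\cdot\eta_{(2)})(\xi_{(1)}\cdot y),$$ and $D^dX=\bigoplus_{e+f=d}\mathrm{Inv}^eX\otimes(\mathrm{Inv}^fX)^*$; then $DX=\bigoplus_{d\ge0}D^dX$ as superalgebras. Divided powers. $\mathrm{Sym}\,V$ is the quotient of the tensor superalgebra of $V$ by the ideal generated by $v\otimes u-(v\otimes u)^{(1,2)}$ ($u,v\in V$) and $v\otimes v$ ($v\in V_{\bar1}$). For a $\mathbb Z$-superspace $V$, ${}'\mathrm{Sym}\,V=\bigoplus_d{}'\mathrm{Sym}^dV$ is the $\mathbb Z$-subalgebra of $\mathrm{Sym}(V\otimes\mathbb Q)$ generated by all $v^m/m!$ ($v\in V_{\bar0}$, $m\ge0$) and all $v\in V_{\bar1}$. The natural map $X^*\to(\mathrm{Inv}\,X)^*$ extends to a superalgebra isomorphism $\mathrm{Sym}(X^* )\cong(\mathrm{Inv}\,X)^*$, used as an identification (also over $\mathbb Q$). Then ${}'\mathrm{Sym}(X^* )\subseteq(\mathrm{Inv}\,X_{\mathbb Q})^*$, with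 $X_{\mathbb Q}=X\otimes\mathbb Q$, is stable under the left and right actions of $\mathrm{Inv}\,X$, so ${}'DX:=\mathrm{Inv}\,X\otimes{}'\mathrm{Sym}(X^* )$ is closed under the product $(\xi\otimes x)(\eta\otimes y)=\sum(-1)^{\bar\xi_{(1)}(\bar\xi_{(2)}+\bar\eta+\bar x)+\bar\eta_{(1)}\bar x}\,\xi_{(2)}\eta_{(1)}\otimes(x\cdot\eta_{(2)})(\xi_{(1)}\cdot y)$ in the Turner double $D(X_{\mathbb Q})=\mathrm{Inv}\,X_{\mathbb Q}\otimes(\mathrm{Inv}\,X_{\mathbb Q})^*$; it contains $DX$. Set ${}'D^dX=\bigoplus_{e+f=d}\mathrm{Inv}^eX\otimes{}'\mathrm{Sym}^f(X^* )$. Schur doubles. $M_n(A)$ is the matrix superalgebra (parity of a matrix determined by the parity of its entries); $D^A(n,d):=D^dM_n(A)$ and ${}'D^A(n,d):={}'D^dM_n(A)$. *)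

(* Defs.v *)
From HB Require Import structures.
From mathcomp Require Import all_boot all_order all_fingroup all_algebra.
From mathcomp Require Import boolp classical_sets.

Set Implicit Arguments.
Unset Strict Implicit.
Unset Printing Implicit Defensive.

Import GRing.Theory.
Local Open Scope classical_set_scope.
Local Open Scope ring_scope.

(** * Tensor products of finite-dimensional vector spaces *)

(* An element of U (x) V is stored by its coordinates on the tensor products of
   the basis vectors in [vbasis fullv]. *)
Definition tens (F : fieldType) (U V : vectType F) :=
  'M[F]_(\dim {:U}, \dim {:V}).

Section Tensor.
Variables (F : fieldType) (U V : vectType F).

Definition tensor (u : U) (v : V) : tens U V :=
  \matrix_(i, j) (coord (vbasis {:U}) i u * coord (vbasis {:V}) j v).

(* The linear map on U (x) V induced by a bilinear map B, see [tlift_tensor];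
   [tlift B (Delta xi)] renders a Sweedler sum of the terms B xi_(1) xi_(2). *)
Definition tlift (W : lmodType F) (B : U -> V -> W) (z : tens U V) : W :=
  \sum_i \sum_j z i j *: B (vbasis {:U})`_i (vbasis {:V})`_j.

Lemma tlift_tensor (W : lmodType F) (B : U -> V -> W)
    (Bl : forall v, linear (B^~ v)) (Br : forall u, linear (B u)) u v :
  tlift B (tensor u v) = B u v.
Proof.
have Bl0 v' : B 0 v' = 0.
  by have := Bl v' (-1) 0 0; rewrite !scaleN1r oppr0 addr0 addNr.
have Br0 u' : B u' 0 = 0.
  by have := Br u' (-1) 0 0; rewrite !scaleN1r oppr0 addr0 addNr.
have Bsl v' n (c : 'I_n -> F) (x : 'I_n -> U) :
    B (\sum_i c i *: x i) v' = \sum_i c i *: B (x i) v'.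
  elim: n c x => [|n IH] c x; first by rewrite !big_ord0 Bl0.
  by rewrite !big_ord_recl Bl IH.
have Bsr u' n (c : 'I_n -> F) (x : 'I_n -> V) :
    B u' (\sum_i c i *: x i) = \sum_i c i *: B u' (x i).
  elim: n c x => [|n IH] c x; first by rewrite !big_ord0 Br0.
  by rewrite !big_ord_recl Br IH.
rewrite [in RHS](coord_vbasis (memvf u)) Bsl; apply: eq_bigr => i _.
rewrite [in RHS](coord_vbasis (memvf v)) Bsr scaler_sumr.
by apply: eq_bigr => j _; rewrite scalerA mxE.
Qed.

End Tensor.

(** * Z-superalgebras that are free of finite rank *)

(* A ring A with a homogeneous Z-basis: A_0 and A_1 are the Z-spans of the
   [bvec j] with [bpar j = false] and [bpar j = true].  That 1 is even follows
   from the other axioms. *)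
Record superalg_basis (A : pzRingType) := SuperalgBasis {
  bidx : finType;
  bpar : bidx -> bool;
  bvec : bidx -> A;
  bcoord : A -> {ffun bidx -> int};
  bcoordK : forall a, \sum_j bvec j *~ bcoord a j = a;
  bvecK : forall c : {ffun bidx -> int}, bcoord (\sum_j bvec j *~ c j) = c;
  bmul_par : forall i j k,
    bcoord (bvec i * bvec j) k != 0 -> bpar k = bpar i (+) bpar j
}.

Section MatrixSuperalgebra.
Variables (A : pzRingType) (B : superalg_basis A) (n : nat).

Definition mx_bidx : finType := ('I_n * 'I_n * bidx B)%type.
Definition mx_bpar (k : mx_bidx) : bool := bpar k.2.
Definition mx_bvec (k : mx_bidx) : 'M[A]_n :=
  \matrix_(i, j) if (i, j) == k.1 then bvec k.2 else 0.
Definition mx_bcoord (M : 'M[A]_n) : {ffun mx_bidx -> int} :=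
  [ffun k => bcoord B (M k.1.1 k.1.2) k.2].

Lemma mx_bvec_sum (c : {ffun mx_bidx -> int}) i j :
  (\sum_k mx_bvec k *~ c k) i j = \sum_l bvec l *~ c (i, j, l).
Proof.
rewrite summxE (eq_bigr (fun k : mx_bidx => (if (i, j) == k.1 then
  bvec k.2 else 0) *~ c (k.1, k.2))); last first.
  move=> [k l] _ /=; rewrite -[in LHS]scaler_int !mxE /=.
  by case: ifP => _; rewrite ?mulr0 ?mul0rz // mulrzl.
rewrite -(pair_bigA _ (fun (k : 'I_n * 'I_n) (l : bidx B) =>
  (if (i, j) == k then bvec l else 0) *~ c (k, l))) /=.
rewrite (bigD1 (i, j)) //= [X in _ + X]big1 ?addr0.
  by apply: eq_bigr => l _; rewrite eqxx.
move=> k /negbTE kij; rewrite big1 // => l _.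
by rewrite eq_sym kij mul0rz.
Qed.

Lemma mx_bcoordK M : \sum_k mx_bvec k *~ mx_bcoord M k = M.
Proof.
apply/matrixP => i j; rewrite mx_bvec_sum -[RHS](bcoordK B).
by apply: eq_bigr => l _; rewrite ffunE.
Qed.

Lemma mx_bvecK (c : {ffun mx_bidx -> int}) :
  mx_bcoord (\sum_k mx_bvec k *~ c k) = c.
Proof.
apply/ffunP => -[[i j] l]; rewrite ffunE /= mx_bvec_sum.
rewrite (eq_bigr (fun l => bvec l *~ [ffun l => c (i, j, l)] l)).
  by rewrite bvecK ffunE.
by move=> l' _; rewrite ffunE.
Qed.

Lemma bcoord0 : bcoord B 0 = [ffun=> 0].
Proof.
rewrite -[RHS](@bvecK A B); congr bcoord.
by rewrite big1 // => j _; rewrite ffunE mulr0z.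
Qed.

Lemma mx_bmul_par i j k :
  mx_bcoord (mx_bvec i * mx_bvec j) k != 0 -> mx_bpar k = mx_bpar i (+) mx_bpar j.
Proof.
case: i j k => [[i1 i2] i] [[j1 j2] j] [[k1 k2] k].
rewrite ffunE mxE /= /mx_bpar /=.
rewrite (bigD1 i2) //= big1 ?addr0; last first.
  by move=> m mi; rewrite !mxE /= xpair_eqE (negbTE mi) andbF mul0r.
rewrite !mxE /= !xpair_eqE eqxx andbT.
case: ifP => _; last by rewrite mul0r bcoord0 ffunE eqxx.
case: ifP => _; last by rewrite mulr0 bcoord0 ffunE eqxx.
exact: bmul_par.
Qed.

Definition mx_superalg_basis : superalg_basis 'M[A]_n :=
  SuperalgBasis mx_bcoordK mx_bvecK mx_bmul_par.

End MatrixSuperalgebra.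

(** * Invariants of tensor powers, and their duals *)

(* In all that follows X_Q = X (x) Q, and X_Q itself only occurs through the
   coordinates on the given basis of X. *)
Section Double.
Variables (X : pzRingType) (B : superalg_basis X).
Local Notation I := (bidx B).

(* X_Q^{(x) d} *)
Definition tpow (d : nat) := {ffun d.-tuple I -> rat^o}.

Definition tbasis d (s : d.-tuple I) : tpow d := [ffun t => (t == s)%:R].

(* The coefficient of x on the basis tensor indexed by the word l; it is 0
   unless l has length d. *)
Definition tcoef d (x : tpow d) (l : seq I) : rat := oapp x 0 (insub l).

Definition tpar (l : seq I) : bool := odd (count (@bpar X B) l).

Definition thom (p : bool) d (x : tpow d) : tpow d :=
  [ffun s : d.-tuple I => if tpar s == p then x s else 0].

Definition perm_sign_exp d (g : 'S_d) (s : d.-tuple I) : nat :=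
  \sum_(a < d) \sum_(c < d | (a < c)%N && (g^-1%g c < g^-1%g a)%N)
    (bpar (tnth s a) * bpar (tnth s c))%N.

Definition tact d (g : 'S_d) (x : tpow d) : tpow d :=
  \sum_(s : d.-tuple I)
    ((-1) ^+ perm_sign_exp g s * x s) *: tbasis [tuple tnth s (g a) | a < d].

Definition swap_sign_exp d (s t : d.-tuple I) : nat :=
  \sum_(c < d) \sum_(a < d | (a < c)%N) (bpar (tnth s c) * bpar (tnth t a))%N.

Definition tmul d (x y : tpow d) : tpow d :=
  [ffun u : d.-tuple I => \sum_(s : d.-tuple I) \sum_(t : d.-tuple I)
    (-1) ^+ swap_sign_exp s t * (x s * y t) *
    \prod_(a < d) (bcoord B (bvec (tnth s a) * bvec (tnth t a)) (tnth u a))%:~R].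

Lemma tact_linear d (g : 'S_d) : linear (tact g).
Proof.
move=> k x y; rewrite /tact scaler_sumr -big_split /=; apply: eq_bigr => s _.
rewrite !ffunE scalerA -scalerDl; congr (_ *: _).
by rewrite /GRing.scale /= mulrDr mulrCA.
Qed.

Definition inv_space d : {vspace tpow d} :=
  (\bigcap_(g : 'S_d) fixedSpace (linfun (tact g)))%VS.

Lemma inv_spaceP d (x : tpow d) :
  reflect (forall g : 'S_d, tact g x = x) (x \in inv_space d).
Proof.
have E g : linfun (tact g) x = tact g x.
  pose L := GRing.isLinear.Build _ _ _ _ (tact g) (tact_linear g).
  pose f : {linear tpow d -> tpow d} := HB.pack (tact g) L.
  exact: (lfunE f x).
apply: (iffP idP) => [|H].
  by move/subv_bigcapP => H g; apply/eqP; rewrite -E; apply/eqP/fixedSpaceP/H.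
by apply/subv_bigcapP => g _; apply/fixedSpaceP; rewrite E.
Qed.

(* Inv^d X_Q and (Inv^d X_Q)^* *)
Definition inv d := subvs_of (inv_space d).
Definition invdual d := 'Hom(inv d, rat^o).

(* Tensor products, products and homogeneous components of invariant tensors
   are invariant; here and below [vsproj] only changes the type of a tensor,
   except in [coprod]. *)
Definition ihom (p : bool) d (xi : inv d) : inv d :=
  vsproj (inv_space d) (thom p (vsval xi)).

Definition imul d (xi eta : inv d) : inv d :=
  vsproj (inv_space d) (tmul (vsval xi) (vsval eta)).

(* The component of Delta(xi) in Inv^a (x) Inv^b, for xi of degree e; it is 0
   unless e = a + b.  Applying the projections [vsproj] of X_Q^{(x) a} onto
   Inv^a and of X_Q^{(x) b} onto Inv^b to both factors of the deconcatenation
   does not change it, since it lies in Inv^a (x) Inv^b. *)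
Definition coprod a b e (xi : inv e) : tens (inv a) (inv b) :=
  \sum_(s : a.-tuple I) \sum_(t : b.-tuple I)
    tcoef (vsval xi) (s ++ t) *:
    tensor (vsproj (inv_space a) (tbasis s)) (vsproj (inv_space b) (tbasis t)).

Definition dhom (p : bool) f (x : invdual f) : invdual f :=
  linfun (fun xi => x (ihom p xi)).

(* The product of x and y in (Inv X_Q)^*, evaluated in degree g (it is 0
   unless g = e + f).  The sum over p, q runs over the parities of zeta_(1)
   and y. *)
Definition dmul e f g (x : invdual e) (y : invdual f) : invdual g :=
  linfun (fun zeta : inv g =>
    tlift (fun (zeta1 : inv e) (zeta2 : inv f) =>
             \sum_(p : bool) \sum_(q : bool) (-1) ^+ (q * p) *:
               (x (ihom p zeta1) * dhom q y zeta2 : rat^o))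
      (coprod e f zeta)).

Definition dunit : invdual 0 := linfun (fun xi : inv 0 => vsval xi [tuple]).

(* x . xi and xi . x *)
Definition dactr f (x : invdual f) (xi : inv f) : invdual f :=
  linfun (fun eta => x (imul xi eta)).
Definition dactl f (xi : inv f) (x : invdual f) : invdual f :=
  linfun (fun eta => x (imul eta xi)).

(** * The Turner double of X_Q *)

(* An element is given by its components in Inv^e (x) (Inv^f)^*.  Families with
   infinitely many nonzero components are allowed, but the pieces of fixed
   degree e + f = d only contain finitely supported ones. *)
Definition turner := forall e f : nat, tens (inv e) (invdual f).

HB.instance Definition _ := gen_eqMixin turner.
HB.instance Definition _ := gen_choiceMixin turner.

Definition turner_zero : turner := fun e f => 0.
Definition turner_opp (z : turner) : turner := fun e f => - z e f.
Definition turner_add (z w : turner) : turner := fun e f => z e f + w e f.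

Fact turner_addA : associative turner_add.
Proof. by move=> x y z; do 2!apply: functional_extensionality_dep => ?; exact: addrA. Qed.
Fact turner_addC : commutative turner_add.
Proof. by move=> x y; do 2!apply: functional_extensionality_dep => ?; exact: addrC. Qed.
Fact turner_add0 : left_id turner_zero turner_add.
Proof. by move=> x; do 2!apply: functional_extensionality_dep => ?; exact: add0r. Qed.
Fact turner_addN : left_inverse turner_zero turner_opp turner_add.
Proof. by move=> x; do 2!apply: functional_extensionality_dep => ?; exact: addNr. Qed.

HB.instance Definition _ :=
  GRing.isZmodule.Build turner turner_addA turner_addC turner_add0 turner_addN.

(* The product of xi (x) x and eta (x) y, for xi in Inv^{f' + b}, x in
   (Inv^f)^*, eta in Inv^{b + f}, y in (Inv^f')^*.  The product
   xi_(2) eta_(1) and the actions x . eta_(2), xi_(1) . y vanish unless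
   xi_(1), xi_(2), eta_(1), eta_(2) have degrees f', b, b, f.  The booleans
   p1, p2, q1, q2, r are the parities of xi_(1), xi_(2), eta_(1), eta_(2), x. *)
Definition turner_mul_pure b f f' g (xi : inv (f' + b)) (x : invdual f)
    (eta : inv (b + f)) (y : invdual f') : tens (inv b) (invdual g) :=
  tlift (fun (xi1 : inv f') (xi2 : inv b) =>
    tlift (fun (eta1 : inv b) (eta2 : inv f) =>
      \sum_(p1 : bool) \sum_(p2 : bool) \sum_(q1 : bool) \sum_(q2 : bool)
      \sum_(r : bool)
        (-1) ^+ (p1 * (p2 + (q1 + q2) + r) + q1 * r) *:
        tensor (imul (ihom p2 xi2) (ihom q1 eta1))
          (dmul g (dactr (dhom r x) (ihom q2 eta2)) (dactl (ihom p1 xi1) y)))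
      (coprod b f eta))
    (coprod f' b xi).

Definition turner_mul (z w : turner) : turner := fun b g =>
  \sum_(f < g.+1)
    tlift (fun xi x => tlift (fun eta y => turner_mul_pure g xi x eta y)
                         (w (b + f)%N (g - f)%N))
      (z ((g - f) + b)%N f).

(** * Lattices *)

Definition zmod_set (V : zmodType) (H : set V) :=
  H 0 /\ forall x y, H x -> H y -> H (x - y).

(* The image of L (x)_Z M in U (x)_Q V *)
Definition lattice_tens (U V : vectType rat) (L : set U) (M : set V) :
  set (tens U V) := smallest (@zmod_set _) [set tensor x y | x in L & y in M].

(* Inv^d X inside Inv^d X_Q, and (Inv^d X)^* inside (Inv^d X_Q)^* *)
Definition invZ d : set (inv d) :=
  [set xi : inv d | forall s : d.-tuple I, vsval xi s \is a Num.int].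
Definition invdualZ d : set (invdual d) :=
  [set x : invdual d | forall xi : inv d, invZ xi -> x xi \is a Num.int].

Fixpoint dpow (v : invdual 1) (m : nat) : invdual m :=
  if m is m'.+1 then dmul m'.+1 v (dpow v m') else dunit.

(* 'Sym^f(X^* ) inside (Inv^f X_Q)^*: the degree f part of the Z-subalgebra
   generated by divided powers of even elements and by odd elements of X^*,
   which is graded because its generators are homogeneous. *)
Inductive dpsym : forall f : nat, set (invdual f) :=
| dpsym0 f : dpsym (0 : invdual f)
| dpsymB f (x y : invdual f) : dpsym x -> dpsym y -> dpsym (x - y)
| dpsymM e f (x : invdual e) (y : invdual f) :
    dpsym x -> dpsym y -> dpsym (dmul (e + f) x y)
| dpsym_even (v : invdual 1) (m : nat) :
    invdualZ v -> dhom false v = v -> dpsym ((m`!%:R)^-1 *: dpow v m)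
| dpsym_odd (v : invdual 1) : invdualZ v -> dhom true v = v -> dpsym v.

(* The sum over e + f = d of the Inv^e X (x) L^f *)
Definition double_lattice (L : forall f, set (invdual f)) d : set turner :=
  [set z | forall e f, if (e + f == d)%N
                       then lattice_tens (@invZ e) (L f) (z e f)
                       else z e f = 0].

(* D^d X and 'D^d X *)
Definition turnerZ := double_lattice invdualZ.
Definition turnerDP := double_lattice dpsym.

End Double.

Arguments turnerZ {X} B d.
Arguments turnerDP {X} B d.

(** * Schur doubles *)

(* The Turner double of M_n(A_Q), which contains D^A(n,d) and 'D^A(n,d) for
   all d *)
Definition schur_ambient (A : pzRingType) (B : superalg_basis A) (n : nat) :=
  turner (mx_superalg_basis B n).

Definition schur_mul (A : pzRingType) (B : superalg_basis A) (n : nat) :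
    schur_ambient B n -> schur_ambient B n -> schur_ambient B n :=
  @turner_mul _ (mx_superalg_basis B n).
Arguments schur_mul {A} B n z w.

Definition schur_double (A : pzRingType) (B : superalg_basis A) (n d : nat) :
  set (schur_ambient B n) := turnerZ (mx_superalg_basis B n) d.
Arguments schur_double {A} B n d.

Definition schur_double_dp (A : pzRingType) (B : superalg_basis A) (n d : nat) :
  set (schur_ambient B n) := turnerDP (mx_superalg_basis B n) d.
Arguments schur_double_dp {A} B n d.

(** * Symmetric algebras and reduction modulo p *)

Definition symmetric_algebra (k : fieldType) (S : vectType k)
    (mul : S -> S -> S) :=
  exists beta : {biscalar S},
    [/\ forall x y, beta x y = beta y x,
        forall x y z, beta (mul x y) z = beta x (mul y z)
      & forall x, (forall y, beta x y = 0) -> x = 0].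

(* S with product [smul] is C (x) F_p = C/pC, where C is a subalgebra of E,
   and r maps c in C to c (x) 1. *)
Record is_reduction_mod (E : zmodType) (mul : E -> E -> E) (C : set E)
    (p : nat) (S : vectType 'F_p) (smul : S -> S -> S) (r : E -> S) : Prop := {
  reduction_add : forall x y, C x -> C y -> r (x + y) = r x + r y;
  reduction_mul : forall x y, C x -> C y -> r (mul x y) = smul (r x) (r y);
  reduction_surj : forall s, exists2 x, C x & r x = s;
  reduction_ker : forall x, C x -> (r x = 0 <-> exists2 y, C y & x = y *+ p)
}.

Definition symmetric_mod (E : zmodType) (mul : E -> E -> E) (C : set E)
    (p : nat) :=
  exists (S : vectType 'F_p) (smul : S -> S -> S) (r : E -> S),
    is_reduction_mod mul C smul r /\ symmetric_algebra smul.

(* Main.v *)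
From HB Require Import structures.
Require Import Defs.
From mathcomp Require Import all_boot all_order all_fingroup all_algebra.
From mathcomp Require Import boolp classical_sets.
From mathcomp Require Import zify ring.

Set Implicit Arguments.
Unset Strict Implicit.
Unset Printing Implicit Defensive.

Import Order.TTheory GRing.Theory Num.Theory.
Local Open Scope classical_set_scope.
Local Open Scope ring_scope.

(** Let [X] be the superalgebra of [n] by [n] matrices over [A], and let [D] and
    ['D] be the degree [d] parts of its double and of the divided power
    version. The product adds the degrees of the second tensor factors, which
    range from 0 to [d]. The part of degree zero is [S = Inv^d X] for [D], ['D]
    and [C]; the part of degree [d] is the lattice [M = (Inv^d X)^*] for [D],
    the larger lattice ['Sym^d] for ['D], and a lattice [G] in between for [C].

    The heart of the proof is that [G = M] ([top_lattice_int]). Otherwise some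
    [y] in [G] lies outside [M], while [p y] lies in [M] for a prime [p]. Take
    a symmetrizing form on [C / p C]. Elements of degree [d] annihilate those
    of positive degree, so [G] is orthogonal to the latter; by a count of
    dimensions the form pairs [S] and [G] perfectly modulo [p]
    ([bot_pair_nondeg]). The element [y] makes the map from [M / p M] to
    [G / p G] singular, so the image of [M] is too small to separate [S] modulo
    [p]: some [xi] in [S], not divisible by [p], is orthogonal to [M]
    ([bot_pair_degenerate]). For [d <= n] there is [u] in [S] such that
    [xi u] is not divisible by [p] but [u . 'Sym^d] is contained in [M]
    ([matrix_faithful]). Then [(xi u, G) = (xi, u G) = 0], a contradiction.

    Such a [u] is the sum of the rearrangements of a tensor of matrix units in
    the columns [1, ..., d]. The tensors in [S u] only involve words without
    repeated letters, and on these the divided powers have integral values,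
    because the [m!] rearrangements of a word of length [m] contribute equally
    ([dpsym_uniq_int]). If the columns of [u] are matched with a word at which
    the coefficient of [xi] is not divisible by [p], this coefficient
    reappears in [xi u].

    Finally [G = M] implies [C = D] ([symmetric_order_sub]). Evaluating the
    component of degree [d] at the unit is a trace on [D]; it pairs
    [xi (x) x] and [eta (x) y] to [x(eta) y(xi)] ([top_part_mul]), which is a
    perfect pairing of complementary degrees over the integers. The product of
    the lowest non-integral component of an element of [C] with elements of
    complementary degree lies in [G = M], so its trace is an integer, and the
    component is integral after all. *)

(** * Bilinear maps and tensors *)

Definition pack_linear (F : fieldType) (U V : lmodType F) (f : U -> V)
    (f_lin : linear f) : {linear U -> V} :=
  HB.pack f (GRing.isLinear.Build _ _ _ _ f f_lin).

Lemma linfun_of (F : fieldType) (U V : vectType F) (f : U -> V) :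
  linear f -> linfun f =1 f.
Proof. by move=> f_lin x; exact: (lfunE (pack_linear f_lin) x). Qed.

Lemma linear_lincomb (F : fieldType) (U V : lmodType F) (f : U -> V)
    (I : Type) (r : seq I) (P : pred I) (c : I -> F) (x : I -> U) :
  linear f ->
  f (\sum_(i <- r | P i) c i *: x i) = \sum_(i <- r | P i) c i *: f (x i).
Proof.
move=> f_lin; rewrite -[f]/(pack_linear f_lin : U -> V) linear_sum.
by apply: eq_bigr => i _; rewrite linearZ.
Qed.

Lemma linear_map_sum (F : fieldType) (U V : lmodType F) (f : U -> V)
    (I : Type) (r : seq I) (P : pred I) (x : I -> U) :
  linear f -> f (\sum_(i <- r | P i) x i) = \sum_(i <- r | P i) f (x i).
Proof.
by move=> f_lin; rewrite -[f]/(pack_linear f_lin : U -> V) linear_sum.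
Qed.

Lemma linear_map0 (F : fieldType) (U V : lmodType F) (f : U -> V) :
  linear f -> f 0 = 0.
Proof. by move=> f_lin; exact: (linear0 (pack_linear f_lin)). Qed.

Lemma linear_mapZ (F : fieldType) (U V : lmodType F) (f : U -> V) c x :
  linear f -> f (c *: x) = c *: f x.
Proof. by move=> f_lin; exact: (linearZ_LR (pack_linear f_lin)). Qed.

Lemma linear_mapB (F : fieldType) (U V : lmodType F) (f : U -> V) x y :
  linear f -> f (x - y) = f x - f y.
Proof. by move=> f_lin; exact: (linearB (pack_linear f_lin)). Qed.

Lemma linear_fun_sum (F : fieldType) (U V : lmodType F) (I : Type) (r : seq I)
    (P : pred I) (f : I -> U -> V) :
  (forall i, linear (f i)) -> linear (fun x => \sum_(i <- r | P i) f i x).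
Proof.
move=> f_lin k x y; rewrite scaler_sumr -big_split /=.
by apply: eq_bigr => i _; rewrite f_lin.
Qed.

Lemma linear_fun_scale (F : fieldType) (U V : lmodType F) (c : F) (f : U -> V) :
  linear f -> linear (fun x => c *: f x).
Proof. by move=> f_lin k x y; rewrite f_lin scalerDr !scalerA mulrC. Qed.

Lemma linear_fun_comp (F : fieldType) (U V W : lmodType F)
    (f : V -> W) (g : U -> V) :
  linear f -> linear g -> linear (fun x => f (g x)).
Proof. by move=> f_lin g_lin k x y; rewrite g_lin f_lin. Qed.

Section Bilinear.
Variables (F : fieldType) (U V : vectType F).

Definition bilin (W : lmodType F) (b : U -> V -> W) :=
  (forall v, linear (b^~ v)) /\ (forall u, linear (b u)).

Lemma tlift_tensor_bilin (W : lmodType F) (b : U -> V -> W) u v :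
  bilin b -> tlift b (tensor u v) = b u v.
Proof. by case=> bl br; exact: tlift_tensor. Qed.

Lemma tlift_linear (W : lmodType F) (b : U -> V -> W) : linear (tlift b).
Proof.
move=> k z w; rewrite /tlift scaler_sumr -big_split /=; apply: eq_bigr => i _.
rewrite scaler_sumr -big_split /=; apply: eq_bigr => j _.
by rewrite !mxE scalerDl scalerA.
Qed.

Lemma eq_tlift (W : lmodType F) (b b' : U -> V -> W) z :
  (forall u v, b u v = b' u v) -> tlift b z = tlift b' z.
Proof. by move=> bb'; do 2!apply: eq_bigr => ? _; rewrite bb'. Qed.

Lemma tlift_fun_linear (T W : lmodType F) (b : T -> U -> V -> W) z :
  (forall u v, linear (fun t => b t u v)) -> linear (fun t => tlift (b t) z).
Proof.
by move=> b_lin; do 2!apply: linear_fun_sum => ?; apply: linear_fun_scale.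
Qed.

Lemma linear_tlift (W W' : lmodType F) (f : W -> W') (b : U -> V -> W) z :
  linear f -> f (tlift b z) = tlift (fun u v => f (b u v)) z.
Proof.
move=> f_lin; rewrite /tlift -[f]/(pack_linear f_lin : W -> W') linear_sum.
apply: eq_bigr => i _; rewrite linear_sum.
by apply: eq_bigr => j _; rewrite linearZ.
Qed.

Lemma tensor_bilin : bilin (@tensor F U V).
Proof.
split=> [v|u] k x y; apply/matrixP => i j;
  by rewrite !mxE linearP /= ?mulrDl ?mulrDr mulrA // !mulrA (mulrC k).
Qed.

Lemma tens_sum_basis (z : tens U V) :
  z = \sum_i \sum_j z i j *: tensor (vbasis {:U})`_i (vbasis {:V})`_j.
Proof.
apply/matrixP => i j; rewrite summxE (bigD1 i) //= summxE (bigD1 j) //=.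
have cE (W : vectType F) (k l : 'I_(\dim {:W})) :
    coord (vbasis {:W}) k (vbasis {:W})`_l = (l == k)%:R.
  by rewrite coord_free // (basis_free (vbasisP _)).
rewrite !mxE !cE !eqxx !mulr1 !big1 ?addr0 // => k.
  move=> ki; rewrite summxE big1 // => l _.
  by rewrite !mxE !cE (negbTE ki) mul0r mulr0.
by move=> kj; rewrite !mxE !cE (negbTE kj) !mulr0.
Qed.

Lemma tens_linear_ext (W : lmodType F) (f g : tens U V -> W) :
  linear f -> linear g -> (forall u v, f (tensor u v) = g (tensor u v)) ->
  f =1 g.
Proof.
move=> fl gl fg z; rewrite (tens_sum_basis z).
have E (h : tens U V -> W) (hl : linear h) (c : 'I__ -> 'I__ -> F) x :
    h (\sum_i \sum_j c i j *: x i j) = \sum_i \sum_j c i j *: h (x i j).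
  rewrite -[h]/(pack_linear hl : tens U V -> W) linear_sum.
  apply: eq_bigr => i _; rewrite linear_sum.
  by apply: eq_bigr => j _; rewrite linearZ.
rewrite (E _ _ f fl) (E _ _ g gl); do 2!apply: eq_bigr => ? _.
by rewrite fg.
Qed.

End Bilinear.
(** * Invariant tensors in coordinates *)

Lemma signr_int (n : nat) : ((-1) ^+ n : rat) \is a Num.int.
Proof. by rewrite rpredX // rpredN rpred1. Qed.

Section Invariants.
Variables (X : pzRingType) (B : superalg_basis X).
Local Notation I := (bidx B).
Local Notation inv := (Defs.inv B).
Local Notation tpow := (Defs.tpow B).
Local Notation inv_space := (Defs.inv_space B).
Implicit Types (d e f : nat).

Lemma tpowP d (x y : tpow d) : x =1 y -> x = y.
Proof. by move/ffunP. Qed.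

Definition wperm d (g : 'S_d) (s : d.-tuple I) : d.-tuple I :=
  [tuple tnth s (g a) | a < d].

Lemma wpermM d (g h : 'S_d) s : wperm g (wperm h s) = wperm (g * h)%g s.
Proof. by apply: eq_from_tnth => a; rewrite !tnth_mktuple permM. Qed.

Lemma wperm1 d (s : d.-tuple I) : wperm 1%g s = s.
Proof. by apply: eq_from_tnth => a; rewrite !tnth_mktuple perm1. Qed.

Lemma wperm_inj d (g : 'S_d) : injective (wperm g).
Proof.
by apply: (can_inj (g := wperm g^-1%g)) => s; rewrite wpermM mulVg wperm1.
Qed.

Lemma perm_eq_wperm d (g : 'S_d) (s : d.-tuple I) : perm_eq (wperm g s) s.
Proof. by apply/tuple_permP; exists g. Qed.

Lemma tpar_perm (s t : seq I) : perm_eq s t -> tpar s = tpar t.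
Proof. by move=> /seq.permP st; rewrite /tpar st. Qed.

Lemma tactE d (g : 'S_d) (x : tpow d) s :
  tact g x (wperm g s) = (-1) ^+ perm_sign_exp g s * x s.
Proof.
rewrite /tact sum_ffunE (bigD1 s) //= big1 ?addr0.
  by rewrite !ffunE eqxx /GRing.scale /= mulr1.
move=> s' s's; rewrite !ffunE -/(wperm g s') (inj_eq (@wperm_inj _ g)).
by rewrite eq_sym (negbTE s's) scaler0.
Qed.

(** Invariance is tested on single coefficients; in this form it passes to the
    slices and products below. *)
Lemma inv_coordP d (x : tpow d) :
  reflect (forall (g : 'S_d) s,
             x (wperm g s) = (-1) ^+ perm_sign_exp g s * x s)
          (x \in inv_space d).
Proof.
apply: (iffP (inv_spaceP x)) => [H g s|H g]; first by rewrite -tactE H.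
apply: tpowP => t; rewrite -(wperm1 t) -(mulVg g^-1%g) invgK -wpermM.
by rewrite tactE -(H g).
Qed.

Lemma inv_coord d (xi : inv d) (g : 'S_d) s :
  vsval xi (wperm g s) = (-1) ^+ perm_sign_exp g s * vsval xi s.
Proof. exact: (elimT (inv_coordP _) (subvsP xi)). Qed.

Lemma thom_linear p d : linear (@thom X B p d).
Proof.
move=> k x y; apply: tpowP => s; rewrite !ffunE.
by case: ifP => _ //; rewrite scaler0 addr0.
Qed.

Lemma thom_inv p d (x : tpow d) : x \in inv_space d -> thom p x \in inv_space d.
Proof.
move/inv_coordP => H; apply/inv_coordP => g s.
rewrite !ffunE (tpar_perm (perm_eq_wperm g s)).
by case: ifP => _; rewrite ?mulr0 ?H.
Qed.

Lemma ihomE p d (xi : inv d) : vsval (ihom p xi) = thom p (vsval xi).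
Proof. by rewrite vsprojK // thom_inv // subvsP. Qed.

Lemma ihom_linear p d : linear (@ihom X B p d).
Proof. by move=> k x y; rewrite /ihom linearP thom_linear linearP. Qed.

Lemma ihom_ihom p q d (xi : inv d) :
  ihom p (ihom q xi) = if p == q then ihom p xi else 0.
Proof.
apply: subvs_inj; case: eqP => [<-|pq]; rewrite !ihomE.
  by apply: tpowP => s; rewrite !ffunE; case: (_ == p).
apply: tpowP => s; rewrite !ffunE; case: eqP => // sp; case: eqP => // sq.
by case: pq; rewrite -sp.
Qed.

Lemma ihom_sum d (xi : inv d) : ihom false xi + ihom true xi = xi.
Proof.
apply: subvs_inj; rewrite linearD /= !ihomE; apply: tpowP => s; rewrite !ffunE.
by case: tpar; rewrite /= ?add0r ?addr0.
Qed.

Lemma dhomE p f (x : invdual B f) xi : dhom p x xi = x (ihom p xi).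
Proof.
rewrite /dhom linfun_of //; apply: (linear_fun_comp _ (@ihom_linear p f)).
exact: linearP.
Qed.

(** ** Slices of an invariant tensor *)

(** Permuting one of two blocks of positions and fixing the other one shows
    that the slices of an invariant tensor are again invariant. *)
Definition block_fun e f (g : 'S_e) (h : 'S_f) (i : 'I_(e + f)) : 'I_(e + f) :=
  match split i with
  | inl j => lshift f (g j)
  | inr k => rshift e (h k)
  end.

Lemma block_funK e f (g : 'S_e) (h : 'S_f) :
  cancel (block_fun g h) (block_fun g^-1 h^-1).
Proof.
move=> i; rewrite /block_fun; case: (split_ordP i) => j ->.
  by case: split_ordP => k /eqP; rewrite eq_shift // => /eqP <-; rewrite permK.
by case: split_ordP => k /eqP; rewrite eq_shift // => /eqP <-; rewrite permK.
Qed.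

Definition block_perm e f (g : 'S_e) (h : 'S_f) : 'S_(e + f) :=
  perm (can_inj (block_funK g h)).

Lemma block_permV e f (g : 'S_e) (h : 'S_f) :
  (block_perm g h)^-1%g = block_perm g^-1 h^-1.
Proof.
apply/permP => i; apply: (@perm_inj _ (block_perm g h)).
by rewrite permKV !permE -{1}(invgK g) -{1}(invgK h) block_funK.
Qed.

Lemma block_perm_l e f (g : 'S_e) (h : 'S_f) i :
  block_perm g h (lshift f i) = lshift f (g i).
Proof.
rewrite permE /block_fun.
by case: split_ordP => k /eqP; rewrite eq_shift // => /eqP <-.
Qed.

Lemma block_perm_r e f (g : 'S_e) (h : 'S_f) i :
  block_perm g h (rshift e i) = rshift e (h i).
Proof.
rewrite permE /block_fun.
by case: split_ordP => k /eqP; rewrite eq_shift // => /eqP <-.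
Qed.

Lemma wperm_block e f (g : 'S_e) (h : 'S_f) (s : e.-tuple I) (t : f.-tuple I) :
  wperm (block_perm g h) (cat_tuple s t) = cat_tuple (wperm g s) (wperm h t).
Proof.
apply: eq_from_tnth => i; rewrite tnth_mktuple; case: (split_ordP i) => j ->.
  by rewrite block_perm_l !tnth_lshift tnth_mktuple.
by rewrite block_perm_r !tnth_rshift tnth_mktuple.
Qed.

Lemma perm_sign_exp_block e f (g : 'S_e) (h : 'S_f)
    (s : e.-tuple I) (t : f.-tuple I) :
  perm_sign_exp (block_perm g h) (cat_tuple s t) =
  (perm_sign_exp g s + perm_sign_exp h t)%N.
Proof.
rewrite /perm_sign_exp big_split_ord /=; congr (_ + _)%N; apply: eq_bigr => a _.
  rewrite big_mkcond [RHS]big_mkcond big_split_ord /=.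
  rewrite [X in (_ + X)%N]big1 => [|c _].
    rewrite addn0; apply: eq_bigr => c _.
    by rewrite block_permV !block_perm_l !tnth_lshift.
  rewrite block_permV block_perm_l block_perm_r /=; case: ifP => // /andP[_].
  by have := ltn_ord (g^-1%g a); lia.
rewrite big_mkcond [RHS]big_mkcond big_split_ord /= big1 => [|c _].
  rewrite add0n; apply: eq_bigr => c _.
  by rewrite block_permV !block_perm_r /= !ltn_add2l !tnth_rshift.
by case: ifP => //= /andP[]; have := ltn_ord c; lia.
Qed.

Lemma perm_sign_exp1 d (s : d.-tuple I) : perm_sign_exp 1 s = 0%N.
Proof.
rewrite /perm_sign_exp big1 // => a _; rewrite big1 // => c.
by rewrite invg1 !perm1 => /andP[ac ca]; have := ltn_trans ac ca; rewrite ltnn.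
Qed.

Lemma inv_coord_block e f (zeta : inv (e + f)) (g : 'S_e) (h : 'S_f) s t :
  vsval zeta (cat_tuple (wperm g s) (wperm h t)) =
  (-1) ^+ perm_sign_exp g s * (-1) ^+ perm_sign_exp h t
    * vsval zeta (cat_tuple s t).
Proof. by rewrite -wperm_block inv_coord perm_sign_exp_block exprD. Qed.

Definition lslice e f (zeta : tpow (e + f)) (t : f.-tuple I) : tpow e :=
  [ffun s => zeta (cat_tuple s t)].

Lemma lslice_inv e f (zeta : inv (e + f)) t :
  lslice (vsval zeta) t \in inv_space e.
Proof.
apply/inv_coordP => g s; rewrite !ffunE.
by rewrite -{1}(wperm1 t) inv_coord_block perm_sign_exp1 mulr1.
Qed.

Lemma tcoef_tuple d (x : tpow d) (s : d.-tuple I) : tcoef x s = x s.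
Proof. by rewrite /tcoef valK. Qed.

Lemma tpow_sum d (x : tpow d) : x = \sum_s x s *: tbasis s.
Proof.
apply: tpowP => t; rewrite sum_ffunE (bigD1 t) //= big1 => [|s st].
  by rewrite !ffunE eqxx addr0 /GRing.scale /= mulr1.
by rewrite !ffunE eq_sym (negbTE st) scaler0.
Qed.

Lemma coprod_linear a b e : linear (@coprod X B a b e).
Proof.
move=> k x y; rewrite /coprod scaler_sumr -big_split /=; apply: eq_bigr => s _.
rewrite scaler_sumr -big_split /=; apply: eq_bigr => t _.
rewrite scalerA -scalerDl; congr (_ *: _).
by rewrite /tcoef; case: insub => [u|] /=; rewrite ?mulr0 ?addr0 // !ffunE.
Qed.

(** Summing over the first word collects the coefficients of [zeta] into
    slices, which are invariant; so the projections in the definition of the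
    coproduct act trivially on the first factor. *)
Lemma tlift_coprod (W : lmodType rat) e f (b : inv e -> inv f -> W)
    (zeta : inv (e + f)) : bilin b ->
  tlift b (coprod e f zeta) =
  \sum_t b (vsproj _ (lslice (vsval zeta) t)) (vsproj _ (tbasis t)).
Proof.
move=> [bl br]; rewrite /coprod exchange_big /=.
have tl := @tlift_linear _ _ _ _ b.
rewrite (linear_map_sum _ _ _ tl); apply: eq_bigr => t _.
rewrite (linear_map_sum _ _ _ tl) [in RHS](tpow_sum (lslice _ t)).
rewrite (linear_lincomb _ _ _ _ (linear_fun_comp (bl _) (@linearP _ _ _ _ _))).
apply: eq_bigr => s _; rewrite (linear_mapZ _ _ tl) tlift_tensor // ffunE.
by congr (_ *: _); exact: (tcoef_tuple _ (cat_tuple s t)).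
Qed.

End Invariants.
(** * Integrality of products and divided powers *)

Section Duals.
Variables (X : pzRingType) (B : superalg_basis X).
Local Notation I := (bidx B).
Local Notation inv := (Defs.inv B).
Local Notation tpow := (Defs.tpow B).
Local Notation invdual := (Defs.invdual B).
Local Notation inv_space := (Defs.inv_space B).
Implicit Types (d e f : nat).

Definition dmul_form e f (x : invdual e) (y : invdual f) (z1 : inv e)
    (z2 : inv f) : rat^o :=
  \sum_(p : bool) \sum_(q : bool)
    (-1) ^+ (q * p) *: (x (ihom p z1) * y (ihom q z2) : rat^o).

Lemma dmul_form_bilin e f (x : invdual e) (y : invdual f) :
  bilin (dmul_form x y).
Proof.
split=> z; do 2!apply: linear_fun_sum => ?; apply: linear_fun_scale.
  move=> k z1 z2; rewrite ihom_linear linearP /= mulrDl.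
  by rewrite /GRing.scale /= mulrA.
move=> k z1 z2; rewrite ihom_linear linearP /= mulrDr.
by rewrite /GRing.scale /= mulrCA.
Qed.

Lemma dmulE e f g (x : invdual e) (y : invdual f) zeta :
  dmul g x y zeta = tlift (dmul_form x y) (coprod e f zeta).
Proof.
rewrite /dmul linfun_of.
  by apply: eq_tlift => z1 z2; do 2!apply: eq_bigr => ? _; rewrite dhomE.
exact: (linear_fun_comp (@tlift_linear _ _ _ _ _) (@coprod_linear X B e f g)).
Qed.

Lemma dmul_bilin e f g : bilin (@dmul X B e f g).
Proof.
split=> [y|x] k a b; apply/lfunP => zeta; rewrite add_lfunE scale_lfunE !dmulE.
  apply: (tlift_fun_linear (b := fun x => dmul_form x y)) => z1 z2.
  do 2!apply: linear_fun_sum => ?; apply: linear_fun_scale => c u v.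
  by rewrite add_lfunE scale_lfunE mulrDl /GRing.scale /= mulrA.
apply: (tlift_fun_linear (b := fun y => dmul_form x y)) => z1 z2.
do 2!apply: linear_fun_sum => ?; apply: linear_fun_scale => c u v.
by rewrite add_lfunE scale_lfunE mulrDr /GRing.scale /= mulrCA.
Qed.

(** Contracting the first factor of the coproduct of [zeta] with a functional
    leaves an invariant tensor; so a product of functionals is evaluated by
    evaluating its factors one after the other at invariant tensors. *)
Definition contract e f (x : inv e -> rat^o) (zeta : inv (e + f)) : tpow f :=
  [ffun t => x (vsproj (inv_space e) (lslice (vsval zeta) t))].

Lemma contract_inv e f (x : inv e -> rat^o) (zeta : inv (e + f)) :
  linear x -> contract x zeta \in inv_space f.
Proof.
move=> x_lin; apply/inv_coordP => h t; rewrite !ffunE.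
have -> : lslice (vsval zeta) (wperm h t) =
    (-1) ^+ perm_sign_exp h t *: lslice (vsval zeta) t.
  apply: tpowP => s; rewrite !ffunE.
  by rewrite -{1}(wperm1 s) inv_coord_block perm_sign_exp1 mul1r.
by rewrite linearZ_LR (linear_mapZ _ _ x_lin).
Qed.

Lemma dmul_contract e f (x : invdual e) (y : invdual f) (zeta : inv (e + f)) :
  dmul (e + f) x y zeta = \sum_(p : bool) \sum_(q : bool) (-1) ^+ (q * p) *
    y (ihom q (vsproj (inv_space f) (contract (fun z => x (ihom p z)) zeta))).
Proof.
rewrite dmulE (tlift_coprod _ (dmul_form_bilin x y)) exchange_big /=.
apply: eq_bigr => p _; rewrite exchange_big /=; apply: eq_bigr => q _.
rewrite -scaler_sumr [in RHS](tpow_sum (contract _ _)).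
have yq_lin : linear (fun z => y (ihom q (vsproj (inv_space f) z))).
  have yl := linear_fun_comp (@linearP _ _ _ _ y) (@ihom_linear X B q f).
  exact: (linear_fun_comp yl (@linearP _ _ _ _ _)).
rewrite (linear_lincomb _ _ _ _ yq_lin); congr (_ * _).
by apply: eq_bigr => t _; rewrite ffunE.
Qed.

Definition inv_supp (Q : pred (seq I)) d : set (inv d) :=
  [set xi : inv d | invZ xi /\ forall s, vsval xi s != 0 -> Q (val s)].

Lemma inv_supp_ihom Q d (xi : inv d) p :
  inv_supp Q xi -> inv_supp Q (ihom p xi).
Proof.
move=> [xiZ xiQ].
split=> s; rewrite ihomE ffunE; case: ifP => _; rewrite ?eqxx //.
by move=> s0; exact: xiQ.
Qed.

(** Integrality on words in a class closed under subwords is multiplicative: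
    the slices of an integral tensor are integral, and so is the contraction
    with a functional that is integral on them. *)
Lemma dmul_int (Q : pred (seq I)) e f (x : invdual e) (y : invdual f) :
  (forall s t, Q (s ++ t) -> Q s /\ Q t) ->
  (forall xi, inv_supp Q xi -> x xi \is a Num.int) ->
  (forall xi, inv_supp Q xi -> y xi \is a Num.int) ->
  forall zeta, inv_supp Q zeta -> dmul (e + f) x y zeta \is a Num.int.
Proof.
move=> Qcat xZ yZ zeta [zZ zQ]; rewrite dmul_contract.
apply: rpred_sum => p _; apply: rpred_sum => q _.
rewrite rpredM ?signr_int // yZ //; apply: inv_supp_ihom.
have xp_lin : linear (fun z => x (ihom p z)).
  exact: (linear_fun_comp (@linearP _ _ _ _ x) (@ihom_linear X B p e)).
have sE t : vsval (vsproj (inv_space e) (lslice (vsval zeta) t)) =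
    lslice (vsval zeta) t by rewrite vsprojK // lslice_inv.
split=> t; rewrite vsprojK ?contract_inv // ffunE.
  apply: xZ; apply: inv_supp_ihom; split=> s; rewrite sE ffunE //.
  by move/zQ/Qcat => [].
move=> t0; have [s sn0] : exists s, vsval zeta (cat_tuple s t) != 0.
  apply/existsP; apply: contraNT t0; rewrite negb_exists => /forallP z0.
  rewrite (_ : lslice _ t = 0) ?linear0 ?(linear_map0 xp_lin) //.
  by apply: tpowP => s; rewrite !ffunE; move: (z0 s); rewrite negbK => /eqP.
by have [] := Qcat _ _ (zQ _ sn0).
Qed.

Lemma inv_suppT d (xi : inv d) : inv_supp predT xi <-> invZ xi.
Proof. by split=> [[]|]. Qed.

Lemma invdualZ_dmul e f (x : invdual e) (y : invdual f) :
  invdualZ x -> invdualZ y -> invdualZ (dmul (e + f) x y).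
Proof.
move=> xZ yZ zeta /inv_suppT; apply: (@dmul_int predT) => // xi /inv_suppT.
  exact: xZ.
exact: yZ.
Qed.

(** ** Divided powers of even functionals *)

Lemma big_tuple_cons (T : finType) (R : nmodType) m (F : m.+1.-tuple T -> R) :
  \sum_s F s = \sum_(t : m.-tuple T) \sum_j F (cons_tuple j t).
Proof.
rewrite exchange_big pair_big /=.
rewrite (reindex (fun p : T * m.-tuple T => cons_tuple p.1 p.2)) //=.
exists (fun s => (thead s, behead_tuple s)) => [[j t] _|s _] /=.
  by rewrite theadE; congr (_, _); apply: val_inj.
by rewrite [RHS]tuple_eta; apply: val_inj.
Qed.

Lemma inv_space1 (x : tpow 1) : x \in inv_space 1.
Proof.
apply/inv_coordP => g s; have -> : g = 1%g by apply/permP => i; rewrite !ord1.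
by rewrite wperm1 perm_sign_exp1 mul1r.
Qed.

Definition letter_val (v : invdual 1) (j : I) : rat :=
  v (vsproj _ (tbasis [tuple j])).

Lemma letter_val_int (v : invdual 1) j :
  invdualZ v -> letter_val v j \is a Num.int.
Proof. by apply=> s; rewrite vsprojK ?inv_space1 // ffunE rpred_nat. Qed.

Lemma letter_val_even v j : dhom false v = v -> bpar j -> letter_val v j = 0.
Proof.
move=> v0 jodd; rewrite /letter_val -v0 dhomE (_ : ihom _ _ = 0) ?linear0 //.
apply: subvs_inj; rewrite ihomE vsprojK ?inv_space1 //.
apply: tpowP => s; rewrite !ffunE; case: eqP => // s0.
case: eqP => // sj; move: s0; rewrite sj /tpar /= addn0.
by rewrite jodd.
Qed.

Lemma dunitE (xi : inv 0) : dunit B xi = vsval xi [tuple].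
Proof.
by rewrite /dunit linfun_of // => k x y; rewrite linearP /= !ffunE.
Qed.

(** An even functional [v] has no signs, so its powers are the restrictions to
    invariants of its tensor powers. *)
Lemma dpow_even v m (xi : inv m) : dhom false v = v ->
  dpow v m xi = \sum_s vsval xi s * \prod_(a < m) letter_val v (tnth s a).
Proof.
move=> v0; elim: m xi => [|m IHm] xi /=.
  rewrite dunitE (big_pred1 [tuple]) => [|s]; first by rewrite big_ord0 mulr1.
  by rewrite (tuple0 s) /= eqxx.
rewrite (@dmul_contract 1 m) big_bool /= [X in X + _]big1 => [|q _]; last first.
  rewrite (_ : contract _ _ = 0) ?linear0 ?(linear_map0 (@ihom_linear _ _ _ _)).
    by rewrite linear0 mulr0.
  apply: tpowP => t; rewrite !ffunE -v0 dhomE ihom_ihom linear0 //.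
have dpowD z : dpow v m (ihom true z) + dpow v m (ihom false z) = dpow v m z.
  by rewrite -[in RHS](ihom_sum z) linearD addrC.
rewrite add0r big_bool !muln0 !expr0 !mul1r /= dpowD IHm.
have v_lin : linear (fun z => v (ihom false z)).
  exact: (linear_fun_comp (@linearP _ _ _ _ v) (@ihom_linear X B false 1)).
rewrite big_tuple_cons; apply: eq_bigr => t _.
rewrite vsprojK ?contract_inv // ffunE.
rewrite [lslice _ t]tpow_sum linear_sum (linear_map_sum _ _ _ v_lin) mulr_suml.
rewrite big_tuple_cons (big_pred1 [tuple]) => [|s]; last first.
  by rewrite (tuple0 s) /= eqxx.
apply: eq_bigr => j _; rewrite big_ord_recl /= (tnth_nth j) /= mulrA.
rewrite linearZ_LR (linear_mapZ _ _ v_lin) /= -dhomE v0 ffunE.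
congr (_ * _ * _); first by congr (vsval xi _); apply: val_inj.
by apply: eq_bigr => a _; congr letter_val; rewrite !(tnth_nth j).
Qed.

(** Words without repeated letters that have the same set of letters are
    rearrangements of each other, and there are [m!] of them. *)
Lemma sum_uniq_words (T : finType) m (F : m.-tuple T -> rat) :
  (forall s, F s \is a Num.int) -> (forall s, F s != 0 -> uniq s) ->
  (forall (g : 'S_m) s, F [tuple tnth s (g a) | a < m] = F s) ->
  m`!%:R^-1 * \sum_s F s \is a Num.int.
Proof.
move=> FZ Fu Fsym; rewrite (bigID (fun s : m.-tuple T => uniq s)) /= addrC.
rewrite big1 ?add0r => [|s]; last by apply: contraNeq => /Fu.
rewrite (partition_big (fun s : m.-tuple T => [set x in s]) predT) //=.
rewrite mulr_sumr.
apply: rpred_sum => Z _.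
case: (pickP (fun s : m.-tuple T => uniq s && ([set x in s] == Z))) => [s0|no].
  move=> /andP[us0 /eqP Z0].
  pose arr (g : 'S_m) := [tuple tnth s0 (g a) | a < m].
  rewrite (reindex arr) /=; last first.
    have inj0 : injective arr.
      move=> g h /(congr1 (fun t => tnth t)) gh; apply/permP => a.
      have /(tuple_uniqP s0) := us0; apply.
      by have := congr1 (fun t => t a) gh; rewrite /= !tnth_mktuple.
    exists (fun s => odflt 1%g [pick g : 'S_m | arr g == s]).
      move=> g _; case: pickP => [h /eqP/inj0 //|/(_ g)]; by rewrite eqxx.
    move=> s; rewrite inE => /andP[us /eqP sZ]; case: pickP => [h /eqP //|].
    have /tuple_permP[g gE] : perm_eq s s0.
      apply: uniq_perm => // x.
      have : x \in [set x in s0] = (x \in [set x in s]).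
        by rewrite Z0 sZ.
      by rewrite !inE.
    by move/(_ g)/eqP; case; apply: val_inj.
  rewrite (eq_bigr (fun=> F s0)) => [|g _]; last exact: Fsym.
  rewrite (eq_bigl (fun=> true)) => [|g].
    rewrite sumr_const -[#|_|]/(#|'S_m|) card_Sn.
    rewrite -[F s0 *+ _]mulr_natl mulrA mulVf ?mul1r //.
    by rewrite pnatr_eq0 -lt0n fact_gt0.
  have pg : perm_eq (arr g) s0 by apply/tuple_permP; exists g.
  rewrite (perm_uniq pg) us0 /= -Z0; apply/eqP/setP => x.
  by rewrite !inE (perm_mem pg).
by rewrite big_pred0 ?mulr0 ?rpred0.
Qed.

Lemma dunit_int : invdualZ (dunit B).
Proof. by move=> xi xiZ; rewrite dunitE. Qed.

Lemma dpow_int (v : invdual 1) m : invdualZ v -> invdualZ (dpow v m).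
Proof.
move=> vZ; elim: m => [|m IHm]; first exact: dunit_int.
exact: (@invdualZ_dmul 1 m).
Qed.

(** On words without repeated letters the denominators of the divided powers
    disappear: the [m!] rearrangements of such a word contribute equally.
    Products are covered by [dmul_int], as subwords have no repeated letters
    either. *)
Lemma dpsym_uniq_int f (y : invdual f) :
  dpsym y -> forall xi, inv_supp uniq xi -> y xi \is a Num.int.
Proof.
elim=> {f y} [f|f x y _ xZ _ yZ|e f x y _ xZ _ yZ|v m vZ v0|v vZ _] xi xiU.
- by rewrite lfunE rpred0.
- by rewrite add_lfunE opp_lfunE rpredB ?xZ ?yZ.
- apply: (@dmul_int uniq) => // s t.
  by rewrite cat_uniq => /and3P[].
- have [xiZ xiu] := xiU; rewrite scale_lfunE dpow_even //.
  apply: sum_uniq_words => [s|s|g s].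
  + by rewrite rpredM ?rpred_prod // => a _; rewrite letter_val_int.
  + by rewrite mulf_eq0 negb_or => /andP[/xiu].
  rewrite -/(wperm g s) inv_coord.
  have -> : \prod_(a < m) letter_val v (tnth (wperm g s) a) =
      \prod_(a < m) letter_val v (tnth s a).
    rewrite [RHS](reindex_inj (@perm_inj _ g)) /=.
    by apply: eq_bigr => a _; rewrite tnth_mktuple.
  have [/existsP[a sa]|] := boolP [exists a, bpar (tnth s a)].
    by rewrite (bigD1 a) //= letter_val_even // !mul0r !mulr0.
  rewrite negb_exists => /forallP s0; rewrite [perm_sign_exp _ _]big1 ?mul1r //.
  by move=> a _; rewrite big1 // => c _; rewrite (negbTE (s0 a)).
- by apply: vZ; case: xiU.
Qed.

(** Clear for the generators, and [e! f!] divides [(e + f)!]. *)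
Lemma dpsym_fact_int f (y : invdual f) :
  dpsym y -> invdualZ (f`!%:R *: y).
Proof.
elim=> {f y} [f|f x y _ xZ _ yZ|e f x y _ xZ _ yZ|v m vZ v0|v vZ _].
- by rewrite scaler0 => xi _; rewrite lfunE rpred0.
- rewrite scalerBr => xi xiZ.
  by rewrite add_lfunE opp_lfunE rpredB ?xZ ?yZ.
- have -> : (e + f)`!%:R *: dmul (e + f) x y =
      ('C(e + f, e))%:R *: dmul (e + f) (e`!%:R *: x) (f`!%:R *: y).
    rewrite (linear_mapZ _ _ ((dmul_bilin _ _ _).1 _)).
    rewrite (linear_mapZ _ _ ((dmul_bilin _ _ _).2 _)) !scalerA -!natrM.
    congr (_%:R *: _); have := @bin_fact (e + f) e (leq_addr _ _).
    by rewrite addKn => <-; rewrite mulnA.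
  move=> xi xiZ; rewrite scale_lfunE /GRing.scale /= rpredM ?rpred_nat //.
  exact: invdualZ_dmul.
- rewrite scalerA mulfV ?scale1r; first exact: dpow_int.
  by rewrite pnatr_eq0 -lt0n fact_gt0.
- by rewrite scale1r.
Qed.

End Duals.
(** * Multiplication of invariant tensors *)

Section Multiplication.
Variables (X : pzRingType) (B : superalg_basis X).
Local Notation I := (bidx B).
Local Notation bvec := (@bvec X B).
Local Notation inv := (Defs.inv B).
Local Notation tpow := (Defs.tpow B).
Local Notation invdual := (Defs.invdual B).
Local Notation inv_space := (Defs.inv_space B).
Implicit Types (d e f : nat).

(** ** Coordinates of products in [X] *)

Lemma bcoordB (a b : X) k : bcoord B (a - b) k = bcoord B a k - bcoord B b k.
Proof.
rewrite -{1}(bcoordK B a) -{1}(bcoordK B b) -sumrB.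
rewrite (eq_bigr
  (fun j => bvec j *~ [ffun j => bcoord B a j - bcoord B b j] j)).
  by rewrite bvecK ffunE.
by move=> j _; rewrite ffunE mulrzBr.
Qed.

Lemma bcoord_zmod_morphism k : zmod_morphism (fun a => bcoord B a k).
Proof. by move=> a b; exact: bcoordB. Qed.

Lemma bcoord_lincomb (J : finType) (c : J -> int) (v : J -> X) k :
  bcoord B (\sum_j v j *~ c j) k = \sum_j c j * bcoord B (v j) k.
Proof.
pose h : {additive X -> int} := HB.pack (fun a => bcoord B a k)
  (GRing.isZmodMorphism.Build X int (fun a => bcoord B a k)
     (bcoord_zmod_morphism k)).
rewrite -[LHS]/(h _) raddf_sum; apply: eq_bigr => j _.
by rewrite raddfMz /= mulrC -mulrzr intz.
Qed.

Lemma bcoord_bvec i k : bcoord B (bvec i) k = (i == k)%:R.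
Proof.
have -> : bvec i = \sum_j bvec j *~ [ffun j : I => (i == j)%:R : int] j.
  rewrite (bigD1 i) //= ffunE eqxx big1 ?addr0 // => j ji.
  by rewrite ffunE eq_sym (negbTE ji).
by rewrite bvecK ffunE.
Qed.

Lemma bcoord_mulr i (v : X) k :
  bcoord B (bvec i * v) k =
  \sum_j bcoord B v j * bcoord B (bvec i * bvec j) k.
Proof.
rewrite -{1}(bcoordK B v) mulr_sumr -bcoord_lincomb; congr (bcoord B _ k).
by apply: eq_bigr => j _; rewrite mulrzAr.
Qed.

Lemma bcoord_mull i (v : X) k :
  bcoord B (v * bvec i) k =
  \sum_j bcoord B v j * bcoord B (bvec j * bvec i) k.
Proof.
rewrite -{1}(bcoordK B v) mulr_suml -bcoord_lincomb; congr (bcoord B _ k).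
by apply: eq_bigr => j _; rewrite mulrzAl.
Qed.

Definition even_elt (v : X) := forall k, bcoord B v k != 0 -> bpar k = false.

(** The odd part of 1 annihilates every basis vector from the right, because
    right multiplication by 1 preserves parities; hence it annihilates 1. *)
Lemma even_elt1 : even_elt 1.
Proof.
pose o : X := \sum_j bvec j *~ (if bpar j then bcoord B 1 j else 0).
have oE k : bcoord B o k = if bpar k then bcoord B 1 k else 0.
  rewrite bcoord_lincomb (bigD1 k) //= bcoord_bvec eqxx mulr1.
  rewrite big1 ?addr0 // => j jk; by rewrite bcoord_bvec (negbTE jk) mulr0.
have bo0 i k : bcoord B (bvec i * o) k = 0.
  rewrite bcoord_mulr; have [ki|ki] := eqVneq (bpar k) (bpar i).
    apply: big1 => j _; rewrite oE; case: ifP => [oj|]; rewrite ?mul0r //.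
    apply/eqP; rewrite mulf_eq0; apply/orP; right; apply: contraTT oj.
    by move/bmul_par; rewrite ki; case: (bpar i); case: (bpar j).
  transitivity (bcoord B (bvec i * 1) k); last first.
    by rewrite mulr1 bcoord_bvec; case: eqP => // ik; rewrite ik eqxx in ki.
  rewrite bcoord_mulr; apply: eq_bigr => j _; rewrite oE.
  case: ifP => // /negbT ej; rewrite mul0r; apply/esym/eqP.
  rewrite mulf_eq0; apply/orP; right; apply: contraNT ej => /bmul_par kij.
  by move: ki; rewrite kij; case: bpar; case: bpar.
move=> k; apply: contraNF => ok; rewrite -[bcoord B 1 k](_ : bcoord B o k = _).
  rewrite -[o]mul1r -{1}(bcoordK B 1) mulr_suml.
  rewrite (eq_bigr (fun j => (bvec j * o) *~ bcoord B 1 j)) => [|j _].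
    by rewrite bcoord_lincomb big1 // => j _; rewrite bo0 mulr0.
  by rewrite mulrzAl.
by rewrite oE ok.
Qed.

(** ** Products with even tensors *)

Lemma tmul_linear_l d (y : tpow d) : linear (fun x => tmul x y).
Proof.
move=> k x x'; apply: tpowP => u; rewrite !ffunE.
rewrite [in RHS]/GRing.scale /= mulr_sumr -big_split /=; apply: eq_bigr => s _.
rewrite mulr_sumr -big_split /=; apply: eq_bigr => t _.
by rewrite !ffunE /GRing.scale /=; ring.
Qed.

Lemma tmul_linear_r d (x : tpow d) : linear (tmul x).
Proof.
move=> k y y'; apply: tpowP => u; rewrite !ffunE.
rewrite [in RHS]/GRing.scale /= mulr_sumr -big_split /=; apply: eq_bigr => s _.
rewrite mulr_sumr -big_split /=; apply: eq_bigr => t _.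
by rewrite !ffunE /GRing.scale /=; ring.
Qed.

Lemma imul_bilin d : bilin (@imul X B d).
Proof.
by split=> z k x y; rewrite /imul linearP ?tmul_linear_l ?tmul_linear_r linearP.
Qed.

Lemma dactlE f (xi : inv f) x eta : dactl xi x eta = x (imul eta xi).
Proof.
rewrite /dactl linfun_of //.
exact: (linear_fun_comp (@linearP _ _ _ _ x) ((imul_bilin f).1 xi)).
Qed.

Lemma dactrE f x (xi : inv f) eta : dactr x xi eta = x (imul xi eta).
Proof.
rewrite /dactr linfun_of //.
exact: (linear_fun_comp (@linearP _ _ _ _ x) ((imul_bilin f).2 xi)).
Qed.

Definition even_supp d (x : tpow d) :=
  forall s, x s != 0 -> forall a, bpar (tnth s a) = false.

Lemma tmul_even d (x y : tpow d) u : even_supp y ->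
  tmul x y u = \sum_s \sum_t
    x s * y t * \prod_(a < d) (bcoord B (bvec (tnth s a) * bvec (tnth t a))
                                 (tnth u a))%:~R.
Proof.
move=> y_even; rewrite ffunE; apply: eq_bigr => s _; apply: eq_bigr => t _.
have [->|/y_even t0] := eqVneq (y t) 0; first by rewrite !mulr0 !mul0r.
rewrite [swap_sign_exp _ _]big1 ?mul1r // => c _.
by rewrite big1 // => a _; rewrite t0 muln0.
Qed.

Lemma sum_prod_words (T : finType) d (F : 'I_d -> T -> rat) :
  \sum_(s : d.-tuple T) \prod_(a < d) F a (tnth s a) =
  \prod_(a < d) \sum_(j : T) F a j.
Proof.
rewrite bigA_distr_bigA.
rewrite (reindex (fun f : {ffun 'I_d -> T} => [tuple f a | a < d])).
  by apply: eq_bigr => f _; apply: eq_bigr => a _; rewrite tnth_mktuple.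
exists (fun s : d.-tuple T => [ffun a => tnth s a]) => [f _|s _].
  by apply/ffunP => a; rewrite ffunE tnth_mktuple.
by apply: eq_from_tnth => a; rewrite tnth_mktuple ffunE.
Qed.

Definition ptens d (v : 'I_d -> X) : tpow d :=
  [ffun s => \prod_(a < d) (bcoord B (v a) (tnth s a))%:~R].

Lemma ptens_int d (v : 'I_d -> X) s : ptens v s \is a Num.int.
Proof. by rewrite ffunE rpred_prod // => a _; rewrite rpred_int. Qed.

Lemma ptens_even d (v : 'I_d -> X) :
  (forall a, even_elt (v a)) -> even_supp (ptens v).
Proof.
move=> v_even s; rewrite ffunE => /prodf_neq0 s0 a.
by apply: (v_even a); have := s0 a isT; rewrite intr_eq0.
Qed.

Lemma tmul_ptens d (x : tpow d) (v : 'I_d -> X) u :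
  (forall a, even_elt (v a)) ->
  tmul x (ptens v) u =
  \sum_s x s * \prod_(a < d) (bcoord B (bvec (tnth s a) * v a) (tnth u a))%:~R.
Proof.
move=> v_even; rewrite tmul_even; last exact: ptens_even.
apply: eq_bigr => s _; under eq_bigr do rewrite -mulrA.
rewrite -mulr_sumr; congr (_ * _).
under eq_bigr do rewrite ffunE -big_split /=.
rewrite (sum_prod_words (fun a j => (bcoord B (v a) j)%:~R *
  (bcoord B (bvec (tnth s a) * bvec j) (tnth u a))%:~R)).
apply: eq_bigr => a _; rewrite bcoord_mulr rmorph_sum.
by apply: eq_bigr => j _; rewrite rmorphM.
Qed.

Lemma prod_delta d (s u : d.-tuple I) :
  \prod_(a < d) ((tnth s a == tnth u a)%:R : int)%:~R = (s == u)%:R :> rat.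
Proof.
have [->|su] := eqVneq s u.
  by rewrite big1 // => a _; rewrite eqxx.
have [a sa] : exists a, tnth s a != tnth u a.
  apply/existsP; apply: contraNT su; rewrite negb_exists => /forallP su.
  by apply/eqP/eq_from_tnth => a; apply/eqP; have := su a; rewrite negbK.
by rewrite (bigD1 a) //= (negbTE sa) mul0r.
Qed.

Definition one_tens d : tpow d := ptens (fun=> 1).

Lemma one_tens_even d : even_supp (one_tens d).
Proof. by apply: ptens_even => a; exact: even_elt1. Qed.

Lemma tmulx1 d (x : tpow d) : tmul x (one_tens d) = x.
Proof.
apply: tpowP => u; rewrite tmul_ptens => [|a]; last exact: even_elt1.
rewrite (bigD1 u) //= [X in _ + X]big1 => [|s su].
  under eq_bigr do rewrite mulr1 bcoord_bvec.
  by rewrite prod_delta eqxx mulr1 addr0.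
under eq_bigr do rewrite mulr1 bcoord_bvec.
by rewrite prod_delta (negbTE su) mulr0.
Qed.

Lemma tmul1x d (y : tpow d) : tmul (one_tens d) y = y.
Proof.
apply: tpowP => u; rewrite ffunE exchange_big /=.
transitivity (\sum_t y t * (t == u)%:R).
  apply: eq_bigr => t _; rewrite -prod_delta.
  transitivity (\sum_(s : d.-tuple I) y t * \prod_(a < d)
      ((bcoord B 1 (tnth s a))%:~R *
       (bcoord B (bvec (tnth s a) * bvec (tnth t a)) (tnth u a))%:~R)).
    apply: eq_bigr => s _; rewrite big_split /=.
    have [s0|/one_tens_even s0] := eqVneq (one_tens d s) 0.
      rewrite s0 mul0r mulr0 mul0r; move: s0; rewrite ffunE => ->.
      by rewrite mul0r mulr0.
    rewrite [swap_sign_exp _ _]big1 ?mul1r => [|c _].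
      by rewrite ffunE mulrA; congr (_ * _); rewrite mulrC.
    by rewrite big1 // => a _; rewrite s0.
  rewrite -mulr_sumr; congr (_ * _).
  rewrite (sum_prod_words (fun a j => (bcoord B 1 j)%:~R *
    (bcoord B (bvec j * bvec (tnth t a)) (tnth u a))%:~R)).
  apply: eq_bigr => a _; rewrite -bcoord_bvec -[bvec (tnth t a) in RHS]mul1r.
  rewrite bcoord_mull rmorph_sum.
  by apply: eq_bigr => j _; rewrite rmorphM.
rewrite (bigD1 u) //= eqxx mulr1 big1 ?addr0 // => t tu.
by rewrite (negbTE tu) mulr0.
Qed.

Lemma even_inv_coord d (x : tpow d) : even_supp x ->
  (forall (g : 'S_d) s, x (wperm g s) = x s) -> x \in inv_space d.
Proof.
move=> x_even xg; apply/inv_coordP => g s; rewrite xg.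
have [->|/x_even s0] := eqVneq (x s) 0; first by rewrite mulr0.
rewrite [perm_sign_exp _ _]big1 ?mul1r // => a _.
by rewrite big1 // => c _; rewrite s0.
Qed.

Lemma even_inv_wperm d (x : tpow d) (g : 'S_d) s : even_supp x ->
  x \in inv_space d -> x (wperm g s) = x s.
Proof.
move=> x_even /inv_coordP->.
have [->|/x_even s0] := eqVneq (x s) 0; first by rewrite mulr0.
rewrite [perm_sign_exp _ _]big1 ?mul1r // => a _.
by rewrite big1 // => c _; rewrite s0.
Qed.

(** For an even second factor the signs in the product disappear, and where it
    does not vanish the word of the product has the parities of the word of
    the first factor. *)
Lemma tmul_even_inv d (x y : tpow d) : even_supp y ->
  x \in inv_space d -> y \in inv_space d -> tmul x y \in inv_space d.
Proof.
move=> y_even x_inv y_inv; apply/inv_coordP => g u; rewrite !tmul_even //.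
rewrite (reindex_inj (@wperm_inj _ _ _ g)) mulr_sumr /=; apply: eq_bigr => s _.
rewrite (reindex_inj (@wperm_inj _ _ _ g)) mulr_sumr /=; apply: eq_bigr => t _.
rewrite (elimT (inv_coordP _) x_inv) even_inv_wperm //.
set P := \prod_(a < d) _; set P' := \prod_(a < d) _.
have -> : P = P'.
  rewrite [P'](reindex_inj (@perm_inj _ g)); apply: eq_bigr => a _.
  by rewrite !tnth_mktuple.
have [->|/y_even t0] := eqVneq (y t) 0; first by rewrite !mulr0 !mul0r mulr0.
have [->|/prodf_neq0 P0] := eqVneq P' 0; first by rewrite !mulr0.
rewrite !mulrA; congr (_ ^+ _ * _ * _ * _).
apply: eq_bigr => a _; apply: eq_bigr => c _.
have su b : bpar (tnth u b) = bpar (tnth s b).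
  have := P0 b isT; rewrite intr_eq0 => /bmul_par ->.
  by rewrite t0 addbF.
by rewrite !su.
Qed.

Lemma tmul_int d (x y : tpow d) : (forall s, x s \is a Num.int) ->
  (forall s, y s \is a Num.int) -> forall s, tmul x y s \is a Num.int.
Proof.
move=> xZ yZ u; rewrite ffunE; apply: rpred_sum => s _; apply: rpred_sum => t _.
rewrite rpredM ?rpred_prod ?rpredM ?signr_int // => a _; exact: rpred_int.
Qed.

(** ** The unit *)

Definition inv1 d : inv d := vsproj (inv_space d) (one_tens d).

Lemma inv1E d : vsval (inv1 d) = one_tens d.
Proof.
rewrite vsprojK //; apply: even_inv_coord => [|g s]; first exact: one_tens_even.
rewrite !ffunE [RHS](reindex_inj (@perm_inj _ g)); apply: eq_bigr => a _.
by rewrite tnth_mktuple.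
Qed.

Lemma inv1_int d : invZ (inv1 d).
Proof. by move=> s; rewrite inv1E ptens_int. Qed.

Lemma ihom1 p d : ihom p (inv1 d) = if p then 0 else inv1 d.
Proof.
have h0 : ihom true (inv1 d) = 0.
  apply: subvs_inj; rewrite ihomE inv1E; apply: tpowP => s; rewrite !ffunE.
  case: eqP => // sp; apply/eqP; apply: contra_eqT sp => /= s0.
  have {}s0 : one_tens d s != 0 by rewrite ffunE.
  rewrite /tpar (eq_in_count (a2 := pred0)) ?count_pred0 // => j /tnthP[a ->].
  exact: one_tens_even s0 a.
by case: p => //; rewrite -[RHS](ihom_sum (inv1 d)) h0 addr0.
Qed.

Lemma imulx1 d (xi : inv d) : imul xi (inv1 d) = xi.
Proof. by rewrite /imul inv1E tmulx1 vsvalK. Qed.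

Lemma imul1x d (xi : inv d) : imul (inv1 d) xi = xi.
Proof. by rewrite /imul inv1E tmul1x vsvalK. Qed.

Lemma lslice1 e f (t : f.-tuple I) :
  lslice (vsval (inv1 (e + f))) t = one_tens f t *: one_tens e.
Proof.
apply: tpowP => s; rewrite ffunE inv1E !ffunE big_split_ord /= mulrC.
by congr (_ * _); apply: eq_bigr => a _; rewrite ?tnth_lshift ?tnth_rshift.
Qed.

Lemma tlift_coprod1 (W : lmodType rat) e f (b : inv e -> inv f -> W) :
  bilin b -> tlift b (coprod e f (inv1 (e + f))) = b (inv1 e) (inv1 f).
Proof.
move=> bb; rewrite tlift_coprod //; case: bb => bl br.
have bp := linear_fun_comp (br (inv1 e))
  (@linearP _ _ _ _ (vsproj (inv_space f))).
rewrite [inv1 f in RHS]/inv1 [one_tens f in RHS]tpow_sum.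
rewrite (linear_lincomb _ _ _ _ bp).
apply: eq_bigr => t _; rewrite lslice1 linearZ_LR.
by rewrite (linear_mapZ _ _ (bl _)).
Qed.

Lemma vsproj_tbasis0 : vsproj (inv_space 0) (tbasis [tuple]) = inv1 0.
Proof.
congr vsproj; apply: tpowP => s; rewrite (tuple0 s) !ffunE eqxx.
by rewrite big_ord0.
Qed.

Lemma coprod0l d (xi : inv d) : coprod 0 d xi = tensor (inv1 0) xi.
Proof.
rewrite /coprod (big_pred1 [tuple]) => [|s]; last by rewrite (tuple0 s) /= eqxx.
rewrite vsproj_tbasis0 -[xi in RHS]vsvalK [in RHS](tpow_sum (vsval xi)).
have bp := linear_fun_comp ((tensor_bilin _ _).2 (inv1 0))
  (@linearP _ _ _ _ (vsproj (inv_space d))).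
rewrite (linear_lincomb _ _ _ _ bp); apply: eq_bigr => t _.
by rewrite tcoef_tuple.
Qed.

Lemma coprod0r d (xi : inv d) : coprod d 0 xi = tensor xi (inv1 0).
Proof.
rewrite -[xi in RHS]vsvalK [in RHS](tpow_sum (vsval xi)) /coprod.
have bp := linear_fun_comp ((tensor_bilin _ _).1 (inv1 0))
  (@linearP _ _ _ _ (vsproj (inv_space d))).
rewrite (linear_lincomb _ _ _ _ bp); apply: eq_bigr => s _.
rewrite (big_pred1 [tuple]) => [|t]; last by rewrite (tuple0 t) /= eqxx.
by rewrite cats0 tcoef_tuple vsproj_tbasis0.
Qed.

(** ** Symmetrized pure tensors *)

Definition sym_ptens d (v : 'I_d -> X) : tpow d :=
  \sum_(g : 'S_d) ptens (fun a => v (g a)).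

Lemma sym_ptens_int d (v : 'I_d -> X) s : sym_ptens v s \is a Num.int.
Proof. by rewrite sum_ffunE rpred_sum // => g _; exact: ptens_int. Qed.

Lemma sym_ptens_even d (v : 'I_d -> X) :
  (forall a, even_elt (v a)) -> even_supp (sym_ptens v).
Proof.
move=> v_even s; rewrite sum_ffunE => s0 a.
have [g sg] : exists g : 'S_d, ptens (fun a => v (g a)) s != 0.
  apply/existsP; apply: contraNT s0; rewrite negb_exists => /forallP s0.
  by rewrite big1 // => g _; apply/eqP; have := s0 g; rewrite negbK.
by apply: (@ptens_even _ (fun a => v (g a))) sg a => b; exact: v_even.
Qed.

Lemma sym_ptens_inv d (v : 'I_d -> X) :
  (forall a, even_elt (v a)) -> sym_ptens v \in inv_space d.
Proof.
move=> v_even; apply: even_inv_coord => [|g s]; first exact: sym_ptens_even.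
rewrite !sum_ffunE (reindex_inj (mulgI g)) /=; apply: eq_bigr => h _.
rewrite !ffunE [RHS](reindex_inj (@perm_inj _ g)) /=; apply: eq_bigr => a _.
by rewrite tnth_mktuple permM.
Qed.

Lemma tmul_sym_ptens d (x : tpow d) (v : 'I_d -> X) u :
  (forall a, even_elt (v a)) ->
  tmul x (sym_ptens v) u = \sum_(g : 'S_d) \sum_s x s *
    \prod_(a < d) (bcoord B (bvec (tnth s a) * v (g a)) (tnth u a))%:~R.
Proof.
move=> v_even; rewrite /sym_ptens (linear_map_sum _ _ _ (tmul_linear_r x)).
by rewrite sum_ffunE; apply: eq_bigr => g _; rewrite tmul_ptens.
Qed.

End Multiplication.
(** * Bases of lattices of integral vectors *)

Lemma clear_denominators (T : finType) (f : T -> rat) :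
  exists2 N : nat, (0 < N)%N & forall t, N%:R * f t \is a Num.int.
Proof.
exists (\prod_t `|denq (f t)|)%N => [|t].
  by rewrite prodn_gt0 // => t; rewrite absz_gt0 denq_neq0.
rewrite (bigD1 t) //= natrM mulrAC rpredM ?rpred_nat //.
by rewrite pmulrn absz_denq mulrC -numqE rpred_int.
Qed.

Lemma intr_mxP (m n : nat) (A : 'M[rat]_(m, n)) :
  (forall i j, A i j \is a Num.int) ->
  exists M : 'M[int]_(m, n), A = map_mx intr M.
Proof.
move=> AZ; exists (map_mx numq A); apply/matrixP => i j; rewrite !mxE.
by have /intrP[k ->] := AZ i j; rewrite numq_int.
Qed.

(** The integral vectors in a rational subspace form a lattice with a basis of
    the subspace as basis.  In a Smith normal form [L D R] of an integral
    matrix with row space the given subspace, the rows of [R] opposite to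
    nonzero entries of [D] are such a basis, as [R] is invertible over the
    integers. *)
Lemma integral_basis (T : finType) (W : {vspace {ffun T -> rat^o}}) :
  exists (r : nat) (e : 'I_r -> {ffun T -> rat^o})
         (phi : 'I_r -> {ffun T -> rat^o} -> rat^o),
    [/\ forall i, e i \in W /\ (forall t, e i t \is a Num.int),
        forall i, linear (phi i),
        forall i (x : {ffun T -> rat^o}),
          (forall t, x t \is a Num.int) -> phi i x \is a Num.int,
        forall x, x \in W -> x = \sum_i phi i x *: e i
      & forall i j, phi i (e j) = (i == j)%:R].
Proof.
pose n := #|T|; pose m := \dim W; pose b := vbasis W.
have [N N_gt0 NZ] :=
  clear_denominators (fun p : 'I_m * T => (b`_p.1 : {ffun T -> rat^o}) p.2).
have N_neq0 : N%:R != 0 :> rat by rewrite pnatr_eq0 -lt0n.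
pose A : 'M[rat]_(m, n) :=
  \matrix_(i, k) (N%:R * (b`_i : {ffun T -> rat^o}) (enum_val k)).
have [M AM] : exists M : 'M[int]_(m, n), A = map_mx intr M.
  by apply: intr_mxP => i j; rewrite mxE; exact: (NZ (i, enum_val j)).
have [L uL [R uR [dd _ ME]]] := int_Smith_normal_form M.
pose D : 'M[int]_(m, n) := \matrix_(i, j) (dd`_i *+ (i == j :> nat)).
pose Lq : 'M[rat]_m := map_mx intr L; pose Rq : 'M[rat]_n := map_mx intr R.
pose Dq : 'M[rat]_(m, n) := map_mx intr D.
have AE : A = Lq *m Dq *m Rq by rewrite AM ME !map_mxM.
have RV : Rq *m map_mx intr (invmx R) = 1%:M.
  by rewrite -map_mxM mulmxV // map_mx1.
have VR : map_mx intr (invmx R) *m Rq = 1%:M.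
  by rewrite -map_mxM mulVmx // map_mx1.
have LV : map_mx intr (invmx L) *m Lq = 1%:M.
  by rewrite -map_mxM mulVmx // map_mx1.
pose rv (x : {ffun T -> rat^o}) : 'rV[rat]_n := \row_k x (enum_val k).
pose y (x : {ffun T -> rat^o}) : 'rV[rat]_n := rv x *m map_mx intr (invmx R).
pose J := [pred j : 'I_n | (j < m)%N && (dd`_j != 0)].
pose w (j : 'I_n) : {ffun T -> rat^o} := [ffun t => Rq j (enum_rank t)].
have rvw j : rv (w j) = row j Rq.
  by apply/rowP => k; rewrite !mxE ffunE enum_valK mxE.
have rv_lin : linear rv by move=> k x x'; apply/rowP => j; rewrite !mxE !ffunE.
have y_lin : linear y by move=> k x x'; rewrite /y rv_lin mulmxDl -scalemxAl.
have yW x j : x \in W -> j \notin J -> y x 0 j = 0.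
  move=> /coord_vbasis xE jJ.
  pose c : 'rV[rat]_m := \row_i (coord b i x / N%:R).
  have rvE : rv x = c *m A.
    apply/rowP => k; rewrite !mxE {1}xE sum_ffunE; apply: eq_bigr => i _.
    by rewrite !mxE ffunE mulrA divfK.
  rewrite /y rvE AE -!mulmxA RV mulmx1 mulmxA mxE big1 // => i _.
  move: jJ; rewrite !mxE inE negb_and negbK.
  have [<-|] := eqVneq (i : nat) j; last by rewrite mulr0.
  by rewrite ltn_ord /= => /eqP->; rewrite mul0rn mulr0.
have wW j : j \in J -> w j \in W.
  rewrite inE => /andP[jm dj0]; pose i0 := Ordinal jm.
  have dq0 : (dd`_j)%:~R != 0 :> rat by rewrite intr_eq0.
  have -> : w j = \sum_i ((dd`_j)%:~R^-1 *
      ((invmx L i0 i)%:~R * N%:R)) *: (b`_i : {ffun T -> rat^o}).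
    apply/ffunP => t.
    rewrite ffunE sum_ffunE; apply: (mulfI dq0); rewrite mulr_sumr.
    transitivity ((map_mx intr (invmx L) *m A) i0 (enum_rank t)).
      rewrite AE !mulmxA LV mul1mx [RHS]mxE (bigD1 j) //= big1 ?addr0.
        by rewrite !mxE eqxx.
      move=> k; rewrite -val_eqE => kj; rewrite !mxE [(_ == _ :> nat)]eq_sym.
      by rewrite (negbTE kj) mul0r.
    rewrite mxE; apply: eq_bigr => i _; rewrite !mxE enum_rankK ffunE.
    by rewrite /GRing.scale /= -mulrA mulVKf // mulrA.
  apply: rpred_sum => i _; apply: rpredZ; apply: vbasis_mem.
  by rewrite mem_nth // size_tuple.
exists #|J|, (fun i => w (enum_val i)), (fun i x => y x 0 (enum_val i)).
split=> [i|i|i x xZ|x xW|i j].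
- split; first exact: wW (enum_valP i).
  by move=> t; rewrite ffunE mxE rpred_int.
- by move=> k x x'; rewrite y_lin !mxE.
- rewrite mxE rpred_sum // => k _; rewrite rpredM // mxE //.
  exact: rpred_int.
- have {1}-> : x = \sum_j y x 0 j *: w j.
    apply/ffunP => t; rewrite sum_ffunE.
    have : rv x = y x *m Rq by rewrite /y -mulmxA VR mulmx1.
    move/rowP/(_ (enum_rank t)); rewrite !mxE enum_rankK => ->.
    by apply: eq_bigr => j _; rewrite !ffunE.
  rewrite (bigID (mem J)) /= [X in _ + X]big1 ?addr0.
    by rewrite big_enum_val.
  by move=> j jJ; rewrite yW // scale0r.
- rewrite /y rvw -row_mul RV !mxE (inj_eq enum_val_inj).
  by rewrite eq_sym; case: eqP.
Qed.

Lemma inv_basis (X : pzRingType) (B : superalg_basis X) d :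
  exists (r : nat) (e : 'I_r -> Defs.inv B d) (phi : 'I_r -> invdual B d),
    [/\ forall i, invZ (e i), forall i, invdualZ (phi i),
        forall x, x = \sum_i phi i x *: e i
      & forall i j, phi i (e j) = (i == j)%:R].
Proof.
have [r [e [phi [eW phi_lin phiZ eE phi_e]]]] := integral_basis (inv_space B d).
have eK i : vsval (vsproj (inv_space B d) (e i)) = e i.
  by rewrite vsprojK //; case: (eW i).
have phiE i (x : Defs.inv B d) :
    (linfun (fun x => phi i (vsval x)) : invdual B d) x = phi i (vsval x).
  by rewrite linfun_of // => k z z'; rewrite linearP phi_lin.
exists r, (fun i => vsproj _ (e i)).
exists (fun i => linfun (fun x => phi i (vsval x))).
split=> [i s|i x xZ|x|i j].
- by rewrite eK; case: (eW i).
- by rewrite phiE; exact: phiZ.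
- apply: subvs_inj; rewrite {1}(eE _ (subvsP x)) linear_sum.
  by apply: eq_bigr => i _; rewrite linearZ_LR phiE [in RHS]/= eK.
- by rewrite phiE eK phi_e.
Qed.

Lemma dual_basis_exp (X : pzRingType) (B : superalg_basis X) d r
    (e : 'I_r -> Defs.inv B d) (phi : 'I_r -> invdual B d) (y : invdual B d) :
  (forall x, x = \sum_i phi i x *: e i) -> y = \sum_j y (e j) *: phi j.
Proof.
move=> eE; apply/lfunP => x; rewrite {1}(eE x) linear_sum sum_lfunE.
apply: eq_bigr => j _.
by rewrite linearZ_LR scale_lfunE /GRing.scale /= mulrC.
Qed.
(** * Products in the Turner double *)

Lemma sum_bool_false (V : nmodType) (F : bool -> V) :
  F true = 0 -> \sum_(p : bool) F p = F false.
Proof. by move=> F1; rewrite big_bool F1 /= add0r. Qed.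

Section TurnerProducts.
Variables (X : pzRingType) (B : superalg_basis X).
Local Notation inv := (Defs.inv B).
Local Notation invdual := (Defs.invdual B).
Local Notation inv1 := (inv1 B).
Implicit Types (b d e f g : nat).

Lemma dhom_linear p f : linear (@dhom X B p f).
Proof.
by move=> k x y; apply/lfunP => xi; rewrite !(dhomE, add_lfunE, scale_lfunE).
Qed.

Lemma dactr_bilin f : bilin (@dactr X B f).
Proof.
split=> [xi|x] k a c; apply/lfunP => eta.
  by rewrite !(dactrE, add_lfunE, scale_lfunE).
by rewrite !(dactrE, add_lfunE, scale_lfunE) (imul_bilin B f).1 linearP.
Qed.

Lemma dactl_bilin f : bilin (@dactl X B f).
Proof.
split=> [x|xi] k a c; apply/lfunP => eta.
  by rewrite !(dactlE, add_lfunE, scale_lfunE) (imul_bilin B f).2 linearP.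
by rewrite !(dactlE, add_lfunE, scale_lfunE).
Qed.

(** ** The product of pure tensors *)

Definition mul_form b f f' g (x : invdual f) (y : invdual f')
    (xi1 : inv f') (xi2 eta1 : inv b) (eta2 : inv f) :
    tens (inv b) (invdual g) :=
  \sum_(p1 : bool) \sum_(p2 : bool) \sum_(q1 : bool) \sum_(q2 : bool)
  \sum_(r : bool)
    (-1) ^+ (p1 * (p2 + (q1 + q2) + r) + q1 * r) *:
    tensor (imul (ihom p2 xi2) (ihom q1 eta1))
      (dmul g (dactr (dhom r x) (ihom q2 eta2)) (dactl (ihom p1 xi1) y)).

(** The degrees [e1] and [e2] are independent of [b], [f] and [f'], as in the
    coproduct itself; this avoids transports along equations of degrees. *)
Definition mul_pure b f f' g e1 e2 (xi : inv e1) (x : invdual f)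
    (eta : inv e2) (y : invdual f') : tens (inv b) (invdual g) :=
  tlift (fun xi1 xi2 => tlift (mul_form g x y xi1 xi2) (coprod b f eta))
    (coprod f' b xi).

Lemma mul_form_linear_x b f f' g y xi1 xi2 eta1 eta2 :
  linear (fun x => @mul_form b f f' g x y xi1 xi2 eta1 eta2).
Proof.
do 5!apply: linear_fun_sum => ?; apply: linear_fun_scale.
apply: (linear_fun_comp ((tensor_bilin _ _).2 _)).
apply: (linear_fun_comp ((dmul_bilin _ _ _ _).1 _)).
apply: (linear_fun_comp ((dactr_bilin _).1 _)).
exact: dhom_linear.
Qed.

Lemma mul_form_linear_y b f f' g x xi1 xi2 eta1 eta2 :
  linear (fun y => @mul_form b f f' g x y xi1 xi2 eta1 eta2).
Proof.
do 5!apply: linear_fun_sum => ?; apply: linear_fun_scale.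
apply: (linear_fun_comp ((tensor_bilin _ _).2 _)).
apply: (linear_fun_comp ((dmul_bilin _ _ _ _).2 _)).
exact: ((dactl_bilin _).2 _).
Qed.

Lemma mul_form_linear_xi1 b f f' g x y xi2 eta1 eta2 :
  linear (fun xi1 => @mul_form b f f' g x y xi1 xi2 eta1 eta2).
Proof.
do 5!apply: linear_fun_sum => ?; apply: linear_fun_scale.
apply: (linear_fun_comp ((tensor_bilin _ _).2 _)).
apply: (linear_fun_comp ((dmul_bilin _ _ _ _).2 _)).
apply: (linear_fun_comp ((dactl_bilin _).1 _)).
exact: ihom_linear.
Qed.

Lemma mul_form_linear_xi2 b f f' g x y xi1 eta1 eta2 :
  linear (fun xi2 => @mul_form b f f' g x y xi1 xi2 eta1 eta2).
Proof.
do 5!apply: linear_fun_sum => ?; apply: linear_fun_scale.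
apply: (linear_fun_comp ((tensor_bilin _ _).1 _)).
apply: (linear_fun_comp ((imul_bilin _ _).1 _)).
exact: ihom_linear.
Qed.

Lemma mul_form_bilin b f f' g x y xi1 xi2 :
  bilin (@mul_form b f f' g x y xi1 xi2).
Proof.
split=> [eta2|eta1]; do 5!apply: linear_fun_sum => ?; apply: linear_fun_scale.
  apply: (linear_fun_comp ((tensor_bilin _ _).1 _)).
  apply: (linear_fun_comp ((imul_bilin _ _).2 _)).
  exact: ihom_linear.
apply: (linear_fun_comp ((tensor_bilin _ _).2 _)).
apply: (linear_fun_comp ((dmul_bilin _ _ _ _).1 _)).
apply: (linear_fun_comp ((dactr_bilin _).2 _)).
exact: ihom_linear.
Qed.

Lemma mul_form_bilin_xi b f f' g x y (z : tens (inv b) (inv f)) :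
  bilin (fun xi1 xi2 => tlift (@mul_form b f f' g x y xi1 xi2) z).
Proof.
split=> [xi2|xi1].
  apply: (tlift_fun_linear (b := fun xi1 => mul_form g x y xi1 xi2)) => u v.
  exact: mul_form_linear_xi1.
apply: (tlift_fun_linear (b := fun xi2 => mul_form g x y xi1 xi2)) => u v.
exact: mul_form_linear_xi2.
Qed.

Lemma mul_pure_bilin_eta b f f' g e1 e2 xi x :
  bilin (@mul_pure b f f' g e1 e2 xi x).
Proof.
split=> [y|eta].
  apply: (tlift_fun_linear (b := fun eta xi1 xi2 =>
    tlift (mul_form g x y xi1 xi2) (coprod b f eta))) => u v.
  exact: (linear_fun_comp (@tlift_linear _ _ _ _ _)
    (@coprod_linear X B b f e2)).
apply: (tlift_fun_linear (b := fun y xi1 xi2 =>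
  tlift (mul_form g x y xi1 xi2) (coprod b f eta))) => u v.
apply: (tlift_fun_linear (b := fun y => mul_form g x y u v)) => u' v'.
exact: mul_form_linear_y.
Qed.

Lemma mul_pure_bilin_xi b f f' g e1 e2 eta y :
  bilin (fun xi x => @mul_pure b f f' g e1 e2 xi x eta y).
Proof.
split=> [x|xi].
  exact: (linear_fun_comp (@tlift_linear _ _ _ _ _)
    (@coprod_linear X B f' b e1)).
apply: (tlift_fun_linear (b := fun x xi1 xi2 =>
  tlift (mul_form g x y xi1 xi2) (coprod b f eta))) => u v.
apply: (tlift_fun_linear (b := fun x => mul_form g x y u v)) => u' v'.
exact: mul_form_linear_x.
Qed.

Lemma tlift_mul_pure b f f' g e1 e2 (xi : inv e1) (x : invdual f)
    (eta : inv e2) (y : invdual f') :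
  tlift (fun xi x =>
      tlift (fun eta y => mul_pure b g xi x eta y) (tensor eta y))
    (tensor xi x) = mul_pure b g xi x eta y.
Proof.
transitivity (tlift (fun xi x => mul_pure b g xi x eta y) (tensor xi x)).
  apply: eq_tlift => u v; apply: tlift_tensor_bilin.
  exact: mul_pure_bilin_eta.
by apply: tlift_tensor_bilin; exact: mul_pure_bilin_xi.
Qed.

(** ** Elements of one bidegree *)

Definition single e0 f0 (t : tens (inv e0) (invdual f0)) : turner B :=
  fun e f => match e0 =P e, f0 =P f with
    | ReflectT He, ReflectT Hf =>
        match He in _ = e', Hf in _ = f' return tens (inv e') (invdual f') with
        | erefl, erefl => t
        end
    | _, _ => 0
    end.

Lemma single_eq e f (t : tens (inv e) (invdual f)) : single t e f = t.
Proof.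
rewrite /single; case: eqP => // He; case: eqP => // Hf.
by rewrite (eq_axiomK He) (eq_axiomK Hf).
Qed.

Lemma single_neq e0 f0 (t : tens (inv e0) (invdual f0)) e f :
  (e0, f0) != (e, f) -> single t e f = 0.
Proof.
move=> /eqP ne; rewrite /single; case: eqP => // He; case: eqP => // Hf.
by case: ne; congr (_, _).
Qed.

Lemma turnerP (z w : turner B) : (forall e f, z e f = w e f) -> z = w.
Proof.
by move=> zw; do 2!apply: functional_extensionality_dep => ?; exact: zw.
Qed.

Lemma single_of (z : turner B) e0 f0 :
  (forall e f, (e0, f0) != (e, f) -> z e f = 0) -> z = single (z e0 f0).
Proof.
move=> z0; apply: turnerP => e f; have [[<- <-]|ne] := eqVneq (e0, f0) (e, f).
  by rewrite single_eq.
by rewrite single_neq // z0.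
Qed.

Lemma turner_zeroE e f : (0 : turner B) e f = 0. Proof. by []. Qed.

Lemma turner_subE (z w : turner B) e f : (z - w) e f = z e f - w e f.
Proof. by []. Qed.

Lemma singleB e f : {morph @single e f : s t / s - t >-> s - t}.
Proof.
move=> s t; apply: turnerP => e' f'; rewrite turner_subE.
have [[<- <-]|ne] := eqVneq (e, f) (e', f'); first by rewrite !single_eq.
by rewrite !single_neq // subrr.
Qed.

Lemma tlift0 (U V : vectType rat) (W : lmodType rat) (c : U -> V -> W) :
  tlift c 0 = 0.
Proof. exact: linear_map0 (@tlift_linear _ _ _ _ c). Qed.

Lemma tlift_fun0 (U V : vectType rat) (W : lmodType rat) (c : U -> V -> W) z :
  (forall u v, c u v = 0) -> tlift c z = 0.
Proof.
by move=> c0; rewrite /tlift; do 2!rewrite big1 // => ? _; rewrite c0 scaler0.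
Qed.

Lemma turner_mulE (z w : turner B) b g :
  turner_mul z w b g = \sum_(f < g.+1) tlift (fun xi x =>
    tlift (fun eta y => mul_pure b g xi x eta y) (w (b + f)%N (g - f)%N))
      (z ((g - f) + b)%N f).
Proof. by []. Qed.

(** Of the sum over the second degrees of [z] one term survives. The degrees
    are related by hypotheses, so that [z] is only evaluated at variables. *)
Lemma turner_mul_single_r (z : turner B) e2 f2 (t : tens (inv e2) (invdual f2))
    b f1 e1 g :
  e1 = (f2 + b)%N -> e2 = (b + f1)%N -> g = (f1 + f2)%N ->
  turner_mul z (single t) b g = tlift (fun xi x =>
    tlift (fun eta y => mul_pure b g xi x eta y) t) (z e1 f1).
Proof.
move=> e1E e2E gE; rewrite turner_mulE.
have f1lt : (f1 < g.+1)%N by rewrite gE ltnS leq_addr.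
rewrite (bigD1 (Ordinal f1lt)) //= big1 ?addr0.
  have gen k k1 k2 : k = f2 -> k1 = e1 -> k2 = e2 ->
      tlift (fun xi x => tlift (fun eta y => mul_pure b g xi x eta y)
        (single t k2 k)) (z k1 f1) =
      tlift (fun xi x => tlift (fun eta y => mul_pure b g xi x eta y) t)
        (z e1 f1).
    by move=> -> -> ->; rewrite single_eq.
  by apply: gen; rewrite ?gE ?addKn // e1E.
move=> f /negP nf; apply: tlift_fun0 => xi x; rewrite single_neq ?tlift0 //.
apply/negP; rewrite xpair_eqE => /andP[/eqP ef /eqP fE]; apply: nf.
by apply/eqP/val_inj => /=; lia.
Qed.

(** ** Top and bottom degree *)

Lemma dunit1 p : dunit B (ihom p (inv1 0)) = (~~ p)%:R.
Proof.
rewrite ihom1; case: p; rewrite ?linear0 // dunitE inv1E ffunE.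
by rewrite big_ord0.
Qed.

Lemma inv0_scalar (xi : inv 0) : xi = dunit B xi *: inv1 0.
Proof.
apply: subvs_inj; rewrite linearZ_LR /= inv1E dunitE.
apply: tpowP => s; rewrite (tuple0 s) ffunE /one_tens ffunE big_ord0.
by rewrite /GRing.scale /= mulr1.
Qed.

Lemma dhom_dunit p : dhom p (dunit B) = if p then 0 else dunit B.
Proof.
apply/lfunP => xi; rewrite dhomE.
have -> : ihom p xi = if p then 0 else xi.
  rewrite (inv0_scalar xi) (linear_mapZ _ _ (@ihom_linear _ _ _ _)) ihom1.
  by case: p; rewrite ?scaler0.
by case: p; rewrite ?linear0 ?lfunE.
Qed.

Lemma dmul_unit_l d (y : invdual d) : dmul d (dunit B) y = y.
Proof.
apply/lfunP => xi; rewrite dmulE coprod0l.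
rewrite tlift_tensor_bilin; last exact: dmul_form_bilin.
rewrite /dmul_form sum_bool_false => [|].
  rewrite dunit1 -[in RHS](ihom_sum xi) linearD big_bool /= addrC.
  by rewrite !muln0 !expr0 !scale1r !mul1r.
by rewrite big1 // => q _; rewrite dunit1 mul0r scaler0.
Qed.

Lemma dactr1 f (x : invdual f) : dactr x (inv1 f) = x.
Proof. by apply/lfunP => eta; rewrite dactrE imul1x. Qed.

Lemma dactl1 f (x : invdual f) : dactl (inv1 f) x = x.
Proof. by apply/lfunP => eta; rewrite dactlE imulx1. Qed.

Lemma tensor0r (U V : vectType rat) (u : U) : tensor u (0 : V) = 0.
Proof. exact: linear_map0 ((tensor_bilin _ _).2 u). Qed.

Lemma tensor0l (U V : vectType rat) (v : V) : tensor (0 : U) v = 0.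
Proof. exact: linear_map0 ((tensor_bilin _ _).1 v). Qed.

Lemma dactl0 f (x : invdual f) : dactl 0 x = 0.
Proof. exact: linear_map0 ((dactl_bilin f).1 x). Qed.

Lemma dactr0 f (x : invdual f) : dactr x 0 = 0.
Proof. exact: linear_map0 ((dactr_bilin f).2 x). Qed.

Lemma dact0r f (xi : inv f) : dactr 0 xi = 0.
Proof. exact: linear_map0 ((dactr_bilin f).1 xi). Qed.

Lemma dmul0r e f g (x : invdual e) : dmul g x (0 : invdual f) = 0.
Proof. exact: linear_map0 ((dmul_bilin _ _ _ _).2 x). Qed.

Lemma dmul0l e f g (y : invdual f) : dmul g (0 : invdual e) y = 0.
Proof. exact: linear_map0 ((dmul_bilin _ _ _ _).1 y). Qed.

Lemma imul0l f (xi : inv f) : imul 0 xi = 0.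
Proof. exact: linear_map0 ((imul_bilin _ _).1 xi). Qed.

Lemma imul0r f (xi : inv f) : imul xi 0 = 0.
Proof. exact: linear_map0 ((imul_bilin _ _).2 xi). Qed.

Section Degree.
Variable d : nat.

Definition bot_elt (xi : inv d) : turner B := single (tensor xi (dunit B)).
Definition top_elt (y : invdual d) : turner B := single (tensor (inv1 0) y).

Lemma mul_pure_bot (xi eta : inv d) :
  mul_pure d 0 xi (dunit B) eta (dunit B) = tensor (imul xi eta) (dunit B).
Proof.
rewrite /mul_pure coprod0l coprod0r tlift_tensor_bilin; last first.
  exact: mul_form_bilin_xi.
rewrite tlift_tensor_bilin; last exact: mul_form_bilin.
rewrite /mul_form sum_bool_false; last first.
  do 4!rewrite big1 // => ? _.
  by rewrite [ihom true _]ihom1 dactl0 dmul0r tensor0r scaler0.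
transitivity (\sum_(p : bool) \sum_(q : bool)
    tensor (imul (ihom p xi) (ihom q eta)) (dunit B)).
  apply: eq_bigr => p _; apply: eq_bigr => q _.
  rewrite sum_bool_false; last first.
    rewrite big1 // => r _.
    by rewrite [ihom true _]ihom1 dactr0 dmul0l tensor0r scaler0.
  rewrite sum_bool_false; last first.
    by rewrite dhom_dunit dact0r dmul0l tensor0r scaler0.
  rewrite dhom_dunit !ihom1 mul0n muln0 addn0 expr0 scale1r.
  by rewrite dactr1 dactl1 dmul_unit_l.
have tl := (tensor_bilin (inv d) (invdual 0)).1 (dunit B).
rewrite -[in RHS](ihom_sum xi) -[in RHS](ihom_sum eta) !big_bool /=.
rewrite -!(linearD (pack_linear tl)) /=; congr tensor.
rewrite -!(linearD (pack_linear ((imul_bilin B d).2 _))) /=.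
rewrite -(linearD (pack_linear ((imul_bilin B d).1 _))) /=.
by congr imul; rewrite addrC.
Qed.

(** In this component the middle factors of the two coproducts have degree 0,
    hence are even, and the signs only involve the three other parities. *)
Lemma mul_pure_top e f g (xi : inv e) (x : invdual f) (eta : inv f)
    (y : invdual e) :
  mul_pure 0 g xi x eta y =
  \sum_(p : bool) \sum_(q : bool) \sum_(r : bool) (-1) ^+ (p * (q + r)) *:
    tensor (inv1 0)
      (dmul g (dactr (dhom r x) (ihom q eta)) (dactl (ihom p xi) y)).
Proof.
rewrite /mul_pure coprod0l coprod0r tlift_tensor_bilin; last first.
  exact: mul_form_bilin_xi.
rewrite tlift_tensor_bilin; last exact: mul_form_bilin.
rewrite /mul_form; apply: eq_bigr => p _.
rewrite sum_bool_false; last first.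
  do 3!rewrite big1 // => ? _.
  by rewrite [ihom true _]ihom1 imul0l tensor0l scaler0.
rewrite sum_bool_false; last first.
  do 2!rewrite big1 // => ? _.
  by rewrite [ihom true (inv1 0)]ihom1 imul0r tensor0l scaler0.
do 2!apply: eq_bigr => ? _.
by rewrite !ihom1 imul1x mul0n !add0n addn0.
Qed.

Lemma mul_bot_bot (xi eta : inv d) :
  turner_mul (bot_elt xi) (bot_elt eta) = bot_elt (imul xi eta).
Proof.
apply: turnerP => b g; have [[<- <-]|ne] := eqVneq (d, 0%N) (b, g).
  rewrite /bot_elt (@turner_mul_single_r _ d 0 _ d 0 d) ?addn0 // single_eq.
  by rewrite single_eq tlift_mul_pure mul_pure_bot.
rewrite [RHS]single_neq // turner_mulE big1 // => f _.
have [[fE k0]|nf] := eqVneq (d, 0%N) ((g - f + b)%N, f : nat); last first.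
  by rewrite [bot_elt xi _ _]single_neq // tlift0.
apply: tlift_fun0 => u v; rewrite [bot_elt eta _ _]single_neq ?tlift0 //.
apply/negP; rewrite xpair_eqE => /andP[/eqP h1 /eqP h2].
by move/negP: ne; apply; apply/eqP; congr (_, _); lia.
Qed.

Lemma mul_bot_top (xi : inv d) (y : invdual d) :
  turner_mul (bot_elt xi) (top_elt y) = top_elt (dactl xi y).
Proof.
apply: turnerP => b g; have [[<- <-]|ne] := eqVneq (0%N, d) (b, g).
  rewrite /bot_elt /top_elt (@turner_mul_single_r _ 0 d _ 0 0 d) ?addn0 //.
  rewrite !single_eq tlift_mul_pure mul_pure_top.
  rewrite -[in RHS](dmul_unit_l (dactl xi y)) -[in RHS](ihom_sum xi).
  transitivity (\sum_(p : bool)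
      tensor (inv1 0) (dmul d (dunit B) (dactl (ihom p xi) y))).
    apply: eq_bigr => p _; rewrite sum_bool_false; last first.
      rewrite big1 // => r _.
      by rewrite [ihom true _]ihom1 dactr0 dmul0l tensor0r scaler0.
    rewrite sum_bool_false; last first.
      by rewrite dhom_dunit dact0r dmul0l tensor0r scaler0.
    by rewrite dhom_dunit ihom1 dactr1 muln0 expr0 scale1r.
  rewrite big_bool /= addrC.
  rewrite -(linearD (pack_linear ((tensor_bilin _ _).2 _))) /=; congr tensor.
  rewrite -(linearD (pack_linear ((dmul_bilin _ _ _ _).2 _))) /=; congr dmul.
  by rewrite -(linearD (pack_linear ((dactl_bilin _).1 _))).
rewrite [RHS]single_neq // turner_mulE big1 // => f _.
have [[fE k0]|nf] := eqVneq (d, 0%N) ((g - f + b)%N, f : nat); last first.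
  by rewrite [bot_elt xi _ _]single_neq // tlift0.
apply: tlift_fun0 => u v; rewrite [top_elt y _ _]single_neq ?tlift0 //.
apply/negP; rewrite xpair_eqE => /andP[/eqP h1 /eqP h2].
by move/negP: ne; apply; apply/eqP; congr (_, _); lia.
Qed.

Lemma mul_top_pos (y : invdual d) (z : turner B) :
  z d 0 = 0 -> turner_mul (top_elt y) z = 0.
Proof.
move=> z0; apply: turnerP => b g; rewrite turner_mulE turner_zeroE.
apply: big1 => f _.
have [[gf df]|nf] := eqVneq (0%N, d) ((g - f + b)%N, f : nat).
  have gen k1 k2 : k1 = d -> k2 = 0%N -> z k1 k2 = 0 by move=> -> ->.
  by apply: tlift_fun0 => u v; rewrite gen ?tlift0 //; lia.
by rewrite [top_elt y _ _]single_neq // tlift0.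
Qed.

Lemma bot_eltB : {morph bot_elt : x y / x - y >-> x - y}.
Proof.
move=> x y; rewrite /bot_elt -singleB.
by rewrite (linear_mapB _ _ ((tensor_bilin _ _).1 _)).
Qed.

Lemma top_eltB : {morph top_elt : x y / x - y >-> x - y}.
Proof.
move=> x y; rewrite /top_elt -singleB.
by rewrite (linear_mapB _ _ ((tensor_bilin _ _).2 _)).
Qed.

(** [Inv^0] is spanned by its unit, so a tensor in [Inv^0 (x) V] is given by an
    element of [V]. *)
Definition top_part (t : tens (inv 0) (invdual d)) : invdual d :=
  tlift (fun a w => dunit B a *: w) t.

Lemma top_part_bilin :
  bilin (fun (a : inv 0) (w : invdual d) => dunit B a *: w).
Proof.
split=> [w|a] k u v; first by rewrite linearP /= scalerDl scalerA.
by rewrite scalerDr !scalerA mulrC.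
Qed.

Lemma top_part_linear : linear top_part.
Proof. exact: tlift_linear. Qed.

Lemma top_part_tensor y : top_part (tensor (inv1 0) y) = y.
Proof.
rewrite /top_part tlift_tensor_bilin; last exact: top_part_bilin.
by have := dunit1 false; rewrite ihom1 => ->; rewrite scale1r.
Qed.

Lemma top_partK t : tensor (inv1 0) (top_part t) = t.
Proof.
apply: (tens_linear_ext (f := fun t => tensor (inv1 0) (top_part t))
                        (g := id)) => //.
  exact: (linear_fun_comp ((tensor_bilin _ _).2 _) top_part_linear).
move=> a w; rewrite /top_part tlift_tensor_bilin; last exact: top_part_bilin.
rewrite [in RHS](inv0_scalar a) (linear_mapZ _ _ ((tensor_bilin _ _).2 _)).
by rewrite (linear_mapZ _ _ ((tensor_bilin _ _).1 _)).
Qed.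

End Degree.

(** The trace form of the Turner double: evaluating the top degree part of a
    product at the unit pairs the first tensor factors with the second ones.
    The signs cancel as only components of equal parities pair. *)
Lemma top_part_mul e f (xi : inv e) (x : invdual f) (eta : inv f)
    (y : invdual e) :
  top_part (mul_pure 0 (f + e)%N xi x eta y) (inv1 (f + e)%N) = x eta * y xi.
Proof.
have lin1 : linear (fun t => top_part t (inv1 (f + e)%N)).
  by move=> k s t; rewrite top_part_linear add_lfunE scale_lfunE.
rewrite mul_pure_top -[x eta](_ : \sum_q x (ihom q eta) = _); last first.
  by rewrite -[in RHS](ihom_sum eta) linearD big_bool /= addrC.
rewrite -[y xi](_ : \sum_p y (ihom p xi) = _); last first.
  by rewrite -[in RHS](ihom_sum xi) linearD big_bool /= addrC.
rewrite mulr_sumr (linear_map_sum _ _ _ lin1); apply: eq_bigr => p _.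
rewrite mulr_suml (linear_map_sum _ _ _ lin1); apply: eq_bigr => q _.
rewrite (linear_map_sum _ _ _ lin1) (bigD1 q) //= [X in _ + X]big1 => [|r rq].
  rewrite (linear_mapZ _ _ lin1) top_part_tensor dmulE.
  rewrite tlift_coprod1; last exact: dmul_form_bilin.
  rewrite /dmul_form sum_bool_false; last first.
    by rewrite big1 // => ? _; rewrite [ihom true _]ihom1 linear0 mul0r scaler0.
  rewrite sum_bool_false; last first.
    by rewrite [ihom true (inv1 e)]ihom1 linear0 mulr0 scaler0.
  rewrite !ihom1 dactrE dactlE imulx1 imul1x dhomE ihom_ihom eqxx addr0.
  rewrite muln0 expr0 scale1r addnn -muln2 mulnA exprM sqrr_sign.
  by case: p => //=; rewrite ?scale1r.
rewrite (linear_mapZ _ _ lin1) top_part_tensor dmulE.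
rewrite tlift_coprod1; last exact: dmul_form_bilin.
rewrite /dmul_form big1 ?scaler0 // => a _; rewrite big1 // => c _.
rewrite dactrE dhomE ihom1; case: a; rewrite ?imulx1 ?imul0r.
  by rewrite (linear_map0 (@ihom_linear _ _ _ _)) linear0 mul0r scaler0.
by rewrite ihom_ihom (negbTE rq) linear0 mul0r scaler0.
Qed.

Lemma top_part_mul_single (z : turner B) e f (eta : inv f) (y : invdual e) :
  top_part (turner_mul z (single (tensor eta y)) 0 (f + e)%N) (inv1 (f + e)%N) =
  tlift (fun (xi : inv e) (x : invdual f) => x eta * y xi : rat^o) (z e f).
Proof.
have lin1 : linear (fun t => top_part t (inv1 (f + e)%N) : rat^o).
  by move=> k s t; rewrite top_part_linear add_lfunE scale_lfunE.
rewrite (@turner_mul_single_r _ _ _ _ _ f e) ?addn0 //.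
apply: etrans (linear_tlift _ _ lin1) _; apply: eq_tlift => xi x /=.
rewrite tlift_tensor_bilin; last exact: mul_pure_bilin_eta.
exact: top_part_mul.
Qed.

End TurnerProducts.
(** * Lattices in the Turner double *)

Section ZmodSets.
Variables (V : zmodType) (H : set V).
Hypothesis H_zmod : zmod_set H.

Lemma zmod_setN x : H x -> H (- x).
Proof.
by move=> Hx; rewrite -sub0r; apply: H_zmod.2 => //; exact: H_zmod.1.
Qed.

Lemma zmod_setD x y : H x -> H y -> H (x + y).
Proof.
by move=> Hx Hy; rewrite -[y]opprK; apply: H_zmod.2 => //; exact: zmod_setN.
Qed.

Lemma zmod_set_sum (I : Type) (s : seq I) (P : pred I) (x : I -> V) :
  (forall i, P i -> H (x i)) -> H (\sum_(i <- s | P i) x i).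
Proof.
by move=> Hx; elim/big_ind: _ => //; [exact: H_zmod.1|exact: zmod_setD].
Qed.

Lemma zmod_setMz x k : H x -> H (x *~ k).
Proof.
move=> Hx; have Hn n : H (x *+ n).
  elim: n => [|n IHn]; first by rewrite mulr0n; exact: H_zmod.1.
  by rewrite mulrS; exact: zmod_setD.
by case: k => n; rewrite ?NegzE ?mulrNz; [|apply: zmod_setN]; exact: Hn.
Qed.

End ZmodSets.

(** Division by one prime factor of [N] after the other must leave [H] at some
    point. *)
Lemma zmod_set_torsion (V : zmodType) (H : set V) x N :
  (0 < N)%N -> H (x *+ N) -> ~ H x ->
  exists p m, [/\ prime p, ~ H (x *+ m) & H (x *+ m *+ p)].
Proof.
elim/ltn_ind: N => N IHN N_gt0 HN Hx.
have N_gt1 : (1 < N)%N by case: N N_gt0 HN {IHN} => [|[]].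
have NE := divnK (pdiv_dvd N); have [HM|HM] := pselect (H (x *+ (N %/ pdiv N))).
  apply: (IHN (N %/ pdiv N)%N) => //.
    by rewrite ltn_Pdiv ?prime_gt1 ?pdiv_prime.
  by rewrite divn_gt0 ?pdiv_gt0 // dvdn_leq // pdiv_dvd.
exists (pdiv N), (N %/ pdiv N)%N; split=> //; first exact: pdiv_prime.
by rewrite -mulrnA NE.
Qed.

Lemma zmod_map_sum (U V : zmodType) (h : U -> V) (I : finType)
    (x : I -> U) (k : I -> int) :
  zmod_morphism h -> h (\sum_i x i *~ k i) = \sum_i h (x i) *~ k i.
Proof.
move=> hB; pose h' : {additive U -> V} :=
  HB.pack h (GRing.isZmodMorphism.Build _ _ h hB).
rewrite -[h]/(h' : U -> V) raddf_sum.
by apply: eq_bigr => i _; rewrite raddfMz.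
Qed.

Lemma scaler_of_int (V : lmodType rat) (v : V) (c : rat) :
  c \is a Num.int -> exists k : int, c *: v = v *~ k.
Proof. by move=> /intrP[k ->]; exists k; rewrite scaler_int. Qed.

Lemma zmod_set_scale (V : lmodType rat) (H : set V) (c : rat) v :
  zmod_set H -> c \is a Num.int -> H v -> H (c *: v).
Proof.
by move=> Hz cZ Hv; have [k ->] := scaler_of_int v cZ; exact: zmod_setMz.
Qed.

Lemma lattice_tens_zmod (U V : vectType rat) (L : set U) (M : set V) :
  zmod_set (lattice_tens L M).
Proof.
split=> [|x y Hx Hy] A [A_zmod GA]; first exact: A_zmod.1.
by apply: A_zmod.2; [apply: Hx|apply: Hy].
Qed.

Lemma lattice_tens_tensor (U V : vectType rat) (L : set U) (M : set V) u v :
  L u -> M v -> lattice_tens L M (tensor u v).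
Proof. by move=> Lu Mv; apply: sub_gen_smallest; exists u => //; exists v. Qed.

Lemma lattice_tens_ind (U V : vectType rat) (L : set U) (M : set V)
    (P : set (tens U V)) :
  zmod_set P -> (forall u v, L u -> M v -> P (tensor u v)) ->
  forall t, lattice_tens L M t -> P t.
Proof.
move=> Pz PT; apply: smallest_sub => // _ [u Lu [v Mv <-]]; exact: PT.
Qed.

Section TurnerLattices.
Variables (X : pzRingType) (B : superalg_basis X).
Local Notation inv := (Defs.inv B).
Local Notation invdual := (Defs.invdual B).
Local Notation inv1 := (inv1 B).
Implicit Types (b d e f g : nat).

Lemma invZ_zmod d : zmod_set (@invZ X B d).
Proof.
split=> [s|x y xZ yZ s]; first by rewrite linear0 ffunE rpred0.
by rewrite linearB /= !ffunE rpredB // ?xZ ?yZ.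
Qed.

Definition divisible d (p : nat) (xi : inv d) :=
  exists2 eta : inv d, invZ eta & xi = eta *+ p.

Lemma invdualZ_zmod f : zmod_set (@invdualZ X B f).
Proof.
split=> [xi _|x y xZ yZ xi xiZ]; first by rewrite lfunE rpred0.
by rewrite add_lfunE opp_lfunE rpredB ?xZ ?yZ.
Qed.

Lemma double_lattice_single (L : forall f, set (invdual f)) d e f
    (t : tens (inv e) (invdual f)) :
  (e + f = d)%N -> lattice_tens (@invZ _ B e) (L f) t ->
  double_lattice L d (single t).
Proof.
move=> <- tL e' f'; have [[<- <-]|ne] := eqVneq (e, f) (e', f').
  by rewrite eqxx single_eq.
by rewrite single_neq //; case: ifP => // _; exact: (lattice_tens_zmod _ _).1.
Qed.

(** The coordinates of [t] on the tensors of dual bases are the values of the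
    pairing at these bases. *)
Lemma lattice_tens_pairing e f (t : tens (inv e) (invdual f)) :
  (forall (eta : inv f) (y : invdual e), invZ eta -> invdualZ y ->
     tlift (fun (xi : inv e) (x : invdual f) => x eta * y xi : rat^o) t
       \is a Num.int) ->
  lattice_tens (@invZ _ B e) (@invdualZ _ B f) t.
Proof.
move=> tZ; have [r1 [e1 [phi1 [e1Z phi1Z e1E phi1_e1]]]] := inv_basis B e.
have [r2 [e2 [phi2 [e2Z phi2Z e2E phi2_e2]]]] := inv_basis B f.
pose T i j (t : tens (inv e) (invdual f)) : rat^o :=
  tlift (fun (xi : inv e) (x : invdual f) => x (e2 j) * phi1 i xi : rat^o) t.
have -> : t = \sum_i \sum_j T i j t *: tensor (e1 i) (phi2 j).
  apply/esym; apply: (tens_linear_ext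
    (f := fun t => \sum_i \sum_j T i j t *: tensor (e1 i) (phi2 j))
    (g := id)) => //.
    do 2!apply: linear_fun_sum => ?.
    move=> k z w; rewrite /T tlift_linear scalerDl; congr (_ + _).
    by rewrite -scalerA.
  move=> u v; rewrite [in RHS](e1E u) [in RHS](dual_basis_exp v e2E).
  rewrite (linear_lincomb _ _ _ _ ((tensor_bilin _ _).1 _)).
  apply: eq_bigr => i _.
  rewrite (linear_lincomb _ _ _ _ ((tensor_bilin _ _).2 _)) scaler_sumr.
  apply: eq_bigr => j _; rewrite scalerA /T tlift_tensor_bilin; last first.
    split=> [x|xi] k a c.
      by rewrite linearP /= mulrDr /GRing.scale /= mulrCA.
    by rewrite add_lfunE scale_lfunE mulrDl /GRing.scale /= mulrA.
  by rewrite mulrC.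
have Lz := lattice_tens_zmod (@invZ _ B e) (@invdualZ _ B f).
apply: (zmod_set_sum Lz) => i _; apply: (zmod_set_sum Lz) => j _.
by apply: (zmod_set_scale Lz); [exact: tZ|exact: lattice_tens_tensor].
Qed.

(** The component of the product of bidegree [(b, g)] involves the second
    degree [f - b] of [z], which is at least [f] only for [b = 0]. *)
Lemma turner_mul_lowest (z : turner B) e f (t : tens (inv f) (invdual e)) b g :
  (forall e' f', (f' < f)%N || (e' + f' != f + e)%N -> z e' f' = 0) ->
  (0%N, (f + e)%N) != (b, g) -> turner_mul z (single t) b g = 0.
Proof.
move=> z0 ne; rewrite turner_mulE big1 // => f0 _; have f0g := ltn_ord f0.
have [[fE eE]|nf] := eqVneq (f, e) ((b + f0)%N, (g - f0)%N); last first.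
  by apply: tlift_fun0 => xi x; rewrite [single t _ _]single_neq // tlift0.
rewrite z0 ?tlift0 //; apply/orP.
have [f0f|f0f] := ltnP f0 f; [by left|right].
by apply: contraNneq ne => sE; apply/eqP; congr (_, _); lia.
Qed.

(** ** Top and bottom components of the divided power double *)

Lemma dpsym0_scalar (y : invdual 0) :
  dpsym y -> exists2 c, c \is a Num.int & y = c *: dunit B.
Proof.
move=> yS; exists (y (inv1 0)).
  have := dpsym_fact_int yS (@inv1_int _ B 0).
  by rewrite fact0 scale1r.
apply/lfunP => xi; rewrite scale_lfunE {1}(inv0_scalar xi) linearZ_LR.
by rewrite /GRing.scale /= mulrC.
Qed.

(** There is nothing to divide in degree 0: ['Sym^0] is spanned by its unit
    over the integers. *)
Lemma turnerDP_bottom d (z : turner B) : turnerDP B d z ->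
  exists2 xi : inv d, invZ xi & z d 0%N = tensor xi (dunit B).
Proof.
move/(_ d 0%N); rewrite addn0 eqxx.
pose P : set (tens (inv d) (invdual 0)) :=
  [set t | exists2 xi : inv d, invZ xi & t = tensor xi (dunit B)].
apply: (@lattice_tens_ind _ _ _ _ P) => [|xi _ xiZ /dpsym0_scalar[c cZ ->]].
  split; first by exists 0; [exact: (invZ_zmod d).1|rewrite tensor0l].
  move=> _ _ [x xZ ->] [y yZ ->]; exists (x - y); first exact: (invZ_zmod d).2.
  by rewrite (linear_mapB _ _ ((tensor_bilin _ _).1 _)).
exists (c *: xi); first exact: (zmod_set_scale (invZ_zmod d)).
rewrite (linear_mapZ _ _ ((tensor_bilin _ _).1 _)).
by rewrite (linear_mapZ _ _ ((tensor_bilin _ _).2 _)).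
Qed.

(** A tensor in [Inv^0 (x) 'Sym^d] has its scalar factor in the integers. *)
Lemma turnerDP_top d (P : set (invdual d)) (y : invdual d) :
  zmod_set P -> (forall x, dpsym x -> P x) -> turnerDP B d (top_elt y) -> P y.
Proof.
move=> Pz PS /(_ 0%N d); rewrite add0n eqxx /top_elt single_eq => yL.
rewrite -(top_part_tensor y); move: (tensor _ _) yL.
apply: (@lattice_tens_ind _ _ _ _ (fun t => P (top_part t))).
  split; first by rewrite (linear_map0 (@top_part_linear _ _ _)); exact: Pz.1.
  move=> s t Ps Pt; rewrite (linear_mapB _ _ (@top_part_linear _ _ _)).
  exact: Pz.2.
move=> a w aZ wS.
rewrite /top_part tlift_tensor_bilin; last exact: top_part_bilin.
apply: (zmod_set_scale Pz); last exact: PS.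
by rewrite dunitE.
Qed.

Lemma tensor_dunit_inj d (xi eta : inv d) :
  tensor xi (dunit B) = tensor eta (dunit B) -> xi = eta.
Proof.
move/(congr1 (tlift (fun (x : inv d) (y : invdual 0) => y (inv1 0) *: x))).
have bl : bilin (fun (x : inv d) (y : invdual 0) => y (inv1 0) *: x).
  split=> [y|x] k u v; first by rewrite scalerDr !scalerA mulrC.
  by rewrite add_lfunE scale_lfunE scalerDl scalerA.
rewrite !tlift_tensor_bilin //; have := dunit1 B false.
by rewrite ihom1 => ->; rewrite !scale1r.
Qed.

End TurnerLattices.
(** * Symmetric orders between the double and its divided power version *)

Lemma Fp_intr_eq0 p (k : int) : prime p -> k%:~R = 0 :> 'F_p ->
  exists m : int, k = m *+ p.
Proof.
move=> p_pr k0; have : `|k|%:R == 0 :> 'F_p.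
  by case: k k0 => n /=; rewrite ?NegzE ?mulrNz => /eqP; rewrite ?oppr_eq0.
rewrite -(dvdn_pcharf (pchar_Fp p_pr)) => /dvdnP[m mE].
exists (sgz k * m%:Z).
by rewrite [LHS]intEsg mE PoszM mulrA -mulr_natr natz.
Qed.

Lemma Fp_nat p (c : 'F_p) : c = (c : nat)%:Z%:~R.
Proof. by rewrite -pmulrn natr_Zp. Qed.

Section SymmetricOrders.
Variables (X : pzRingType) (B : superalg_basis X) (d : nat).
Variable C : set (turner B).
Local Notation inv := (Defs.inv B).
Local Notation invdual := (Defs.invdual B).
Local Notation inv1 := (inv1 B).

Hypothesis C_zmod : zmod_set C.
Hypothesis C_mul : forall x y, C x -> C y -> C (turner_mul x y).
Hypothesis sub_DC : turnerZ B d `<=` C.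
Hypothesis sub_CD : C `<=` turnerDP B d.

Definition top_lattice : set (invdual d) := [set y | C (top_elt y)].

Lemma top_lattice_zmod : zmod_set top_lattice.
Proof.
split=> [|x y Cx Cy]; last by rewrite /top_lattice /= top_eltB; exact: C_zmod.2.
rewrite /top_lattice /= -(subrr 0) top_eltB subrr; exact: C_zmod.1.
Qed.

Lemma bot_elt_mem (xi : inv d) : invZ xi -> C (bot_elt xi).
Proof.
move=> xiZ; apply: sub_DC; apply: double_lattice_single; first exact: addn0.
by apply: lattice_tens_tensor => //; exact: dunit_int.
Qed.

Lemma top_latticeZ (y : invdual d) : invdualZ y -> top_lattice y.
Proof.
move=> yZ; apply: sub_DC; apply: double_lattice_single; first exact: add0n.
by apply: lattice_tens_tensor => //; exact: inv1_int.
Qed.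

Lemma top_lattice_dpsym (P : set (invdual d)) y :
  zmod_set P -> (forall x, dpsym x -> P x) -> top_lattice y -> P y.
Proof. by move=> Pz PS Cy; apply: (turnerDP_top Pz PS); exact: sub_CD. Qed.

Lemma top_lattice_fact y : top_lattice y -> invdualZ (d`!%:R *: y).
Proof.
apply: (top_lattice_dpsym (P := fun y => invdualZ (d`!%:R *: y))).
  split; first by rewrite scaler0; exact: (invdualZ_zmod B d).1.
  by move=> x z xZ zZ; rewrite scalerBr; exact: (invdualZ_zmod B d).2.
exact: dpsym_fact_int.
Qed.

Lemma C_bottom z : C z ->
  exists2 xi : inv d,
    invZ xi & C (z - bot_elt xi) /\ (z - bot_elt xi) d 0%N = 0.
Proof.
move=> Cz; have [xi xiZ zE] := turnerDP_bottom (sub_CD Cz); exists xi => //.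
split; first by apply: C_zmod.2 => //; exact: bot_elt_mem.
by rewrite turner_subE zE /bot_elt single_eq subrr.
Qed.

(** Products in [Inv^d X] are products in [C], whose elements have integral
    components of degree zero. *)
Lemma imul_int (xi eta : inv d) : invZ xi -> invZ eta -> invZ (imul xi eta).
Proof.
move=> xiZ etaZ; have Cm := C_mul (bot_elt_mem xiZ) (bot_elt_mem etaZ).
rewrite mul_bot_bot in Cm; have [zeta zetaZ] := turnerDP_bottom (sub_CD Cm).
by rewrite /bot_elt single_eq => /tensor_dunit_inj ->.
Qed.

Lemma top_elt_mulrn (y : invdual d) n : top_elt (y *+ n) = top_elt y *+ n.
Proof.
pose h : {additive invdual d -> turner B} :=
  HB.pack (@top_elt X B d)
    (GRing.isZmodMorphism.Build _ _ (@top_elt X B d) (@top_eltB X B d)).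
by rewrite -[LHS]/(h _) raddfMn.
Qed.

Lemma turner_mulrn (z : turner B) n e f : (z *+ n) e f = z e f *+ n.
Proof.
elim: n => [|n IHn]; first by rewrite !mulr0n.
by rewrite !mulrS -IHn.
Qed.

(** The ambient space is torsion free, so [w] is the element of top degree
    given by [y / p]. *)
Lemma top_elt_divide (y : invdual d) p w :
  (0 < p)%N -> C w -> top_elt y = w *+ p ->
  exists2 y', top_lattice y' & y = y' *+ p.
Proof.
move=> p_gt0 Cw yE; have p0 : p%:R != 0 :> rat by rewrite pnatr_eq0 -lt0n.
have yE' : y = (p%:R^-1 *: y) *+ p.
  by rewrite -scaler_nat scalerA mulfV ?scale1r.
exists (p%:R^-1 *: y) => //; rewrite /top_lattice /= (_ : top_elt _ = w) //.
apply: turnerP => e f; have := congr1 (fun z : turner B => z e f) yE.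
rewrite {1}yE' top_elt_mulrn !turner_mulrn -!scaler_nat.
by move/(scalerI p0).
Qed.

Section Reduction.
Variables (p : nat) (S : vectType 'F_p).
Variables (smul : S -> S -> S) (r : turner B -> S).
Variable beta : {biscalar S}.
Hypothesis p_pr : prime p.
Hypothesis red : is_reduction_mod (@turner_mul X B) C smul r.
Hypothesis beta_sym : forall x y, beta x y = beta y x.
Hypothesis beta_assoc : forall x y z, beta (smul x y) z = beta x (smul y z).
Hypothesis beta_nondeg : forall x, (forall y, beta x y = 0) -> x = 0.

Lemma redB x y : C x -> C y -> r (x - y) = r x - r y.
Proof.
move=> Cx Cy; have := reduction_add red (C_zmod.2 _ _ Cx Cy) Cy.
by rewrite subrK => ->; rewrite addrK.
Qed.

Lemma red0 : r 0 = 0.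
Proof. by rewrite -(subrr 0) redB ?subrr //; exact: C_zmod.1. Qed.

Lemma red_lincomb (I : finType) (x : I -> turner B) (k : I -> int) :
  (forall i, C (x i)) ->
  r (\sum_i x i *~ k i) = \sum_i (k i)%:~R *: r (x i).
Proof.
move=> Cx; have rD := reduction_add red.
have redMn y n : C y -> r (y *+ n) = r y *+ n.
  move=> Cy; elim: n => [|n IHn]; first by rewrite !mulr0n red0.
  by rewrite !mulrS rD ?IHn //; exact: (zmod_setMz C_zmod (Posz n)).
have redMz y m : C y -> r (y *~ m) = r y *~ m.
  move=> Cy; case: m => n; first exact: redMn.
  rewrite NegzE !mulrNz -sub0r redB ?red0 ?sub0r; first by rewrite redMn.
    exact: C_zmod.1.
  exact: (zmod_setMz C_zmod (Posz n.+1)).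
have Cs (s : seq I) : C (\sum_(i <- s) x i *~ k i).
  by apply: (zmod_set_sum C_zmod) => i _; exact: zmod_setMz.
elim: (index_enum I) => [|i s IHs]; first by rewrite !big_nil red0.
rewrite !big_cons rD //; last exact: zmod_setMz.
by rewrite IHs redMz // scaler_int.
Qed.

Lemma beta_linear_l y : linear (fun x => beta x y : ('F_p)^o).
Proof. by move=> a u v; rewrite linearDl linearZl_LR. Qed.

Lemma beta_linear_r y : linear (fun x => beta y x : ('F_p)^o).
Proof. by move=> a u v; rewrite linearDr linearZr_LR. Qed.

Definition bot_pair (xi : inv d) (y : invdual d) : 'F_p :=
  beta (r (bot_elt xi)) (r (top_elt y)).

Lemma bot_pair_lincomb_l r0 (e : 'I_r0 -> inv d) (k : 'I_r0 -> int) y :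
  (forall i, invZ (e i)) ->
  bot_pair (\sum_i e i *~ k i) y = \sum_i (k i)%:~R * bot_pair (e i) y.
Proof.
move=> eZ; rewrite /bot_pair (zmod_map_sum _ _ (@bot_eltB X B d)) red_lincomb.
  exact: (linear_lincomb _ _ _ _ (beta_linear_l _)).
by move=> i; exact: bot_elt_mem.
Qed.

Lemma bot_pair_lincomb_r r0 xi (y : 'I_r0 -> invdual d) (k : 'I_r0 -> int) :
  (forall i, top_lattice (y i)) ->
  bot_pair xi (\sum_i y i *~ k i) = \sum_i (k i)%:~R * bot_pair xi (y i).
Proof.
move=> yC; rewrite /bot_pair (zmod_map_sum _ _ (@top_eltB X B d)).
rewrite red_lincomb //.
exact: (linear_lincomb _ _ _ _ (beta_linear_r _)).
Qed.

Lemma invZ_coords r0 (e : 'I_r0 -> inv d) (phi : 'I_r0 -> invdual d) xi :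
  (forall i, invdualZ (phi i)) -> (forall x, x = \sum_i phi i x *: e i) ->
  invZ xi -> exists k : 'I_r0 -> int,
    xi = \sum_i e i *~ k i /\ forall i, phi i xi = (k i)%:~R.
Proof.
move=> phiZ eE xiZ; exists (fun i => numq (phi i xi)).
have kE i : phi i xi = (numq (phi i xi))%:~R.
  by have /intrP[k ->] := phiZ i xi xiZ; rewrite numq_int.
split=> //; rewrite {1}(eE xi); apply: eq_bigr => i _.
by rewrite {1}kE scaler_int.
Qed.

(** The top degree part of [C] has full rank modulo [p]: otherwise a nonzero
    [xi] pairs to 0 with lifts of a basis of its reduction, so that the values
    at [xi] of all elements of the top degree part, whose denominators are
    bounded, are divisible by every power of [p]. *)
Lemma top_reduction_free r0 (e : 'I_r0 -> inv d) (phi : 'I_r0 -> invdual d) :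
  (forall i, invZ (e i)) -> (forall i, invdualZ (phi i)) ->
  (forall x, x = \sum_i phi i x *: e i) ->
  (forall i j, phi i (e j) = (i == j)%:R) ->
  forall k, (k <= r0)%N -> exists cs : k.-tuple (invdual d),
    (forall i, top_lattice (tnth cs i)) /\
    free (map (fun y => r (top_elt y)) cs).
Proof.
move=> eZ phiZ eE phi_e; elim=> [|k IHk] k_le.
  by exists [tuple]; split=> [[]//|]; rewrite /= nil_free.
have [cs [csC cs_free]] := IHk (ltnW k_le).
have [span|] := pselect (forall y, top_lattice y ->
    r (top_elt y) \in <<map (fun y => r (top_elt y)) cs>>%VS); last first.
  move=> /existsNP[y /not_implyP[yC /negP ny]].
  exists (cons_tuple y cs); split=> [i|]; last by rewrite /= free_cons ny.
  by case: (unliftP ord0 i) => [j ->|->]; rewrite ?tnthS ?tnth0.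
exfalso.
pose A : 'M[rat]_(r0, k) := \matrix_(i, j) tnth cs j (e i).
(* As [k < r0], some nonzero [v] solves the [k] equations given by [cs]. *)
have /rowV0Pn[v /sub_kermxP vA v0] : kermx A != 0.
  rewrite kermx_eq0 /row_free; apply: contraTneq k_le => rkA.
  by rewrite -leqNgt -rkA rank_leq_col.
have [N N_gt0 NZ] := clear_denominators (fun i => v 0 i).
pose xi := \sum_i (N%:R * v 0 i) *: e i.
have xiZ : invZ xi.
  apply: (zmod_set_sum (invZ_zmod B d)) => i _.
  exact: (zmod_set_scale (invZ_zmod B d)).
have phi_xi i : phi i xi = N%:R * v 0 i.
  rewrite linear_sum (bigD1 i) //= big1 ?addr0 => [|j ji].
    by rewrite linearZ_LR /= phi_e eqxx /GRing.scale /= mulr1.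
  by rewrite linearZ_LR /= phi_e eq_sym (negbTE ji) scaler0.
have cs_xi j : tnth cs j xi = 0.
  rewrite linear_sum; transitivity (N%:R * (v *m A) 0 j); last first.
    by rewrite vA mxE mulr0.
  rewrite mxE mulr_sumr; apply: eq_bigr => i _.
  by rewrite linearZ_LR /= mxE /GRing.scale /= mulrA.
have descent y : top_lattice y ->
    exists2 y', top_lattice y' & y xi = p%:R * y' xi.
  move=> yC; pose rcs := map_tuple (fun y => r (top_elt y)) cs.
  pose c i : 'F_p := coord rcs i (r (top_elt y)).
  have yE : r (top_elt y) = \sum_i c i *: rcs`_i.
    exact: coord_span (span y yC).
  (* [y0] has the same reduction as [y], and vanishes at [xi]. *)
  pose y0 : invdual d := \sum_(i < k) tnth cs i *~ (c i : nat)%:Z.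
  have y0C : top_lattice y0.
    apply: (zmod_set_sum top_lattice_zmod) => i _.
    exact: (zmod_setMz top_lattice_zmod).
  have yy0C : top_lattice (y - y0) by exact: top_lattice_zmod.2.
  have r0E : r (top_elt (y - y0)) = 0.
    rewrite top_eltB redB // (zmod_map_sum _ _ (@top_eltB X B d)).
    rewrite red_lincomb //.
    rewrite yE -sumrB big1 // => i _.
    by rewrite -Fp_nat -tnth_nth tnth_map subrr.
  have [w Cw wE] := (reduction_ker red yy0C).1 r0E.
  have [y' y'C y'E] := top_elt_divide (prime_gt0 p_pr) Cw wE.
  exists y' => //; rewrite -[y](subrK y0) add_lfunE y'E.
  have -> : y0 xi = 0.
    rewrite sum_lfunE big1 // => i _.
    by rewrite -scaler_int scale_lfunE cs_xi scaler0.
  by rewrite addr0 -scaler_nat scale_lfunE.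
have power n y : top_lattice y ->
    exists2 y', top_lattice y' & y xi = p%:R ^+ n * y' xi.
  elim: n y => [|n IHn] y yC; first by exists y; rewrite ?mul1r.
  have [y1 y1C ->] := descent y yC; have [y2 y2C ->] := IHn y1 y1C.
  by exists y2; rewrite // exprS mulrA.
have zero y : top_lattice y -> y xi = 0.
  move=> yC; have /intrP[m mE] := top_lattice_fact yC xiZ.
  apply/eqP; rewrite -(mulrI_eq0 _ (mulfI (_ : d`!%:R != 0))); last first.
    by rewrite pnatr_eq0 -lt0n fact_gt0.
  rewrite scale_lfunE in mE; rewrite [_ * _]mE intr_eq0.
  have [y' y'C yE] := power `|m|%N y yC.
  have /intrP[m' m'E] := top_lattice_fact y'C xiZ.
  rewrite scale_lfunE in m'E.
  have : m = p%:Z ^+ `|m| * m'.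
    apply: (@intr_inj rat); rewrite -mE rmorphM rmorphXn /= -m'E yE.
    by rewrite /GRing.scale /= mulrCA.
  move/(congr1 absz); rewrite abszM abszX /= => mabs.
  rewrite -absz_eq0; apply: contraTT isT => m0.
  have : (p ^ `|m| <= `|m|)%N.
    rewrite {2}mabs leq_pmulr // lt0n; apply: contraNneq m0 => m'0.
    by rewrite mabs m'0 muln0.
  by rewrite leqNgt ltn_expl // prime_gt1.
case/negP: v0; apply/eqP/rowP => i; rewrite mxE; apply/eqP.
have N0 : N%:R != 0 :> rat by rewrite pnatr_eq0 -lt0n.
by rewrite -(mulrI_eq0 _ (mulfI N0)) -phi_xi zero //; exact: top_latticeZ.
Qed.

(** For [y] of top degree and [z] of positive degree, [y z = 0] and
    [y = 1 y], so that the form vanishes at [(y, z) = (1 y, z) = (1, y z)]. As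
    the form is nondegenerate, the top degree part pairs perfectly with the
    part of degree zero, which has the same rank modulo [p]. *)
Lemma bot_pair_nondeg (xi : inv d) : invZ xi ->
  (forall y, top_lattice y -> bot_pair xi y = 0) ->
  divisible p xi.
Proof.
move=> xiZ xi0; have [r0 [e [phi [eZ phiZ eE phi_e]]]] := inv_basis B d.
have [cs [csC cs_free]] := top_reduction_free eZ phiZ eE phi_e (leqnn r0).
have [k [kE _]] := invZ_coords phiZ eE xiZ.
pose M : 'M['F_p]_r0 := \matrix_(i, j) bot_pair (e i) (tnth cs j).
have [k0|] := pselect (forall i, (k i)%:~R = 0 :> 'F_p).
  have [m mE] := choice (fun i => Fp_intr_eq0 p_pr (k0 i)).
  exists (\sum_i e i *~ m i).
    apply: (zmod_set_sum (invZ_zmod B d)) => i _.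
    exact: (zmod_setMz (invZ_zmod B d)).
  rewrite -sumrMnl kE; apply: eq_bigr => i _.
  by rewrite mE -mulr_natr natz mulrzA -pmulrn.
move=> /existsNP[i0 /eqP ki0]; exfalso.
have /det0P[w w0 wM] : \det M^T == 0.
  rewrite det_tr; apply/det0P; exists (\row_i (k i)%:~R).
    by apply: contraNneq ki0 => /rowP/(_ i0); rewrite !mxE => ->.
  apply/rowP => j; rewrite !mxE -[RHS](xi0 (tnth cs j)) // kE.
  rewrite bot_pair_lincomb_l //.
  by apply: eq_bigr => i _; rewrite !mxE.
(* If the Gram matrix is singular, a combination [W] of independent elements
   of top degree is orthogonal to degree zero, hence to everything. *)
pose W := \sum_j w 0 j *: r (top_elt (tnth cs j)).
suff W0 : W = 0.
  case/negP: w0; apply/eqP/rowP => j; rewrite mxE.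
  have /freeP fr : free (map_tuple (fun y => r (top_elt y)) cs) by [].
  apply: (fr (fun j => w 0 j)); rewrite -[RHS]W0.
  by apply: eq_bigr => i _; rewrite -tnth_nth tnth_map.
apply: beta_nondeg => s; rewrite beta_sym.
have [z Cz <-] := reduction_surj red s.
have [eta etaZ [Cz' z'0]] := C_bottom Cz.
rewrite -(subrK (bot_elt eta) z) (reduction_add red) //; last first.
  exact: bot_elt_mem.
rewrite linearDl [X in X + _](_ : _ = 0) ?add0r; last first.
  rewrite /W (linear_lincomb _ _ _ _ (beta_linear_r _)) big1 // => j _.
  have bot1 : C (bot_elt (inv1 d)) by apply: bot_elt_mem; exact: inv1_int.
  rewrite beta_sym -[top_elt (tnth cs j)](_ :
    turner_mul (bot_elt (inv1 d)) (top_elt (tnth cs j)) = _); last first.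
    by rewrite mul_bot_top dactl1.
  have csCj : C (top_elt (tnth cs j)) by exact: csC.
  rewrite (reduction_mul red) // beta_assoc -(reduction_mul red) //.
  by rewrite mul_top_pos // red0 linear0r scaler0.
have [k' [-> _]] := invZ_coords phiZ eE etaZ.
rewrite /W (linear_lincomb _ _ _ _ (beta_linear_r _)).
under eq_bigr do rewrite -/(bot_pair _ _) bot_pair_lincomb_l // scaler_sumr.
rewrite exchange_big big1 //= => i _.
transitivity ((k' i)%:~R * (w *m M^T) 0 i); last by rewrite wM mxE mulr0.
rewrite mxE mulr_sumr; apply: eq_bigr => j _; rewrite !mxE.
by rewrite /GRing.scale /= mulrCA.
Qed.

(** Expanding [p y] in a dual basis gives a linear relation between the
    reductions of the basis elements, because [p y] reduces to 0; it is
    nontrivial modulo [p], because [y] is not integral. So the Gram matrix of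
    degree zero and the integral functionals is singular. *)
Lemma bot_pair_degenerate (y : invdual d) : top_lattice y -> ~ invdualZ y ->
  invdualZ (y *+ p) ->
  exists xi : inv d, [/\ invZ xi, ~ divisible p xi
    & forall x, invdualZ x -> bot_pair xi x = 0].
Proof.
move=> yC yZ pyZ; have [r0 [e [phi [eZ phiZ eE phi_e]]]] := inv_basis B d.
have int_exp (x : invdual d) : invdualZ x -> exists m : 'I_r0 -> int,
    x = \sum_j phi j *~ m j /\ forall j, x (e j) = (m j)%:~R.
  move=> xZ; exists (fun j => numq (x (e j))).
  have mE j : x (e j) = (numq (x (e j)))%:~R.
    by have /intrP[k ->] := xZ _ (eZ j); rewrite numq_int.
  split=> //; rewrite {1}(dual_basis_exp x eE); apply: eq_bigr => j _.
  by rewrite {1}mE scaler_int.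
have phiC i : top_lattice (phi i) by exact: top_latticeZ.
have [m [pyE mE]] := int_exp _ pyZ.
pose M : 'M['F_p]_r0 := \matrix_(i, j) bot_pair (e i) (phi j).
have p0 : p%:R != 0 :> rat by rewrite pnatr_eq0 -lt0n prime_gt0.
have [j0 mj0] : exists j, (m j)%:~R != 0 :> 'F_p.
  apply/existsP; apply: contra_notT yZ; rewrite negb_exists => /forallP m0.
  rewrite (dual_basis_exp y eE).
  apply: (zmod_set_sum (invdualZ_zmod B d)) => j _.
  apply: (zmod_set_scale (invdualZ_zmod B d)) => //.
  have /Fp_intr_eq0[//|q qE] : (m j)%:~R = 0 :> 'F_p.
    by apply/eqP; have := m0 j; rewrite negbK.
  have := mE j; rewrite -scaler_nat scale_lfunE qE -[q *+ p]mulr_natl.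
  by rewrite rmorphM rmorph_nat => /(mulfI p0) ->; rewrite rpred_int.
have /det0P[a a0 aM] : \det M == 0.
  rewrite -det_tr; apply/det0P; exists (\row_j (m j)%:~R).
    by apply: contraNneq mj0 => /rowP/(_ j0); rewrite !mxE => ->.
  apply/rowP => i; rewrite !mxE.
  transitivity (bot_pair (e i) (y *+ p)).
    rewrite pyE bot_pair_lincomb_r //; apply: eq_bigr => j _; by rewrite !mxE.
  rewrite /bot_pair [r (top_elt _)](_ : _ = 0) ?linear0r //.
  have pyC : C (top_elt (y *+ p)) by exact: top_latticeZ.
  apply: (reduction_ker red pyC).2.
  by exists (top_elt y); rewrite // top_elt_mulrn.
pose xi : inv d := \sum_i e i *~ (a 0 i : nat)%:Z.
have xiZ : invZ xi.
  apply: (zmod_set_sum (invZ_zmod B d)) => i _.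
  exact: (zmod_setMz (invZ_zmod B d)).
exists xi; split=> // [[eta etaZ xiE]|x xZ].
  case/negP: a0; apply/eqP/rowP => i; rewrite mxE.
  have phi_xi : phi i xi = (a 0 i : nat)%:R.
    rewrite linear_sum (bigD1 i) //= big1 ?addr0 => [|j ji].
      by rewrite -scaler_int linearZ_LR /= phi_e eqxx /GRing.scale /= mulr1.
    by rewrite -scaler_int linearZ_LR /= phi_e eq_sym (negbTE ji) scaler0.
  have /intrP[q qE] := phiZ i eta etaZ.
  have : ((a 0 i : nat)%:Z = q * p%:Z).
    apply: (@intr_inj rat); rewrite rmorphM /= -qE -[LHS]phi_xi xiE raddfMn /=.
    by rewrite -mulr_natr.
  move/(congr1 (fun z : int => z%:~R : 'F_p)); rewrite -Fp_nat => ->.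
  by rewrite rmorphM /= -pmulrn (pcharf0 (pchar_Fp p_pr)) mulr0.
have [m' [-> _]] := int_exp x xZ.
rewrite bot_pair_lincomb_r // big1 // => j _.
rewrite bot_pair_lincomb_l // (_ : \sum_i _ = (a *m M) 0 j).
  by rewrite aM [X in _ * X]mxE mulr0.
by rewrite [RHS]mxE; apply: eq_bigr => i _; rewrite mxE -Fp_nat.
Qed.

End Reduction.
End SymmetricOrders.
(** * Integrality of the order *)

Section Maximality.
Variables (X : pzRingType) (B : superalg_basis X) (d : nat).
Local Notation inv := (Defs.inv B).
Local Notation invdual := (Defs.invdual B).
Local Notation inv1 := (inv1 B).

(** The only property of [X] that the argument uses: the left ideal of the [u]
    in [Inv^d X] with [u . 'Sym^d] inside [(Inv^d X)^*] is acted on faithfully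
    by [Inv^d X] modulo each prime. *)
Definition faithful_dp := forall (p : nat) (xi : inv d),
  prime p -> invZ xi -> ~ divisible p xi ->
  exists u : inv d, [/\ invZ u, ~ divisible p (imul xi u)
    & forall y, dpsym y -> invdualZ (dactl u y)].

Variable C : set (turner B).
Hypothesis C_zmod : zmod_set C.
Hypothesis C_mul : forall x y, C x -> C y -> C (turner_mul x y).
Hypothesis sub_DC : turnerZ B d `<=` C.
Hypothesis sub_CD : C `<=` turnerDP B d.
Hypothesis C_sym : forall p, prime p -> symmetric_mod (@turner_mul X B) C p.
Hypothesis C_faithful : faithful_dp.

(** A non-integral [y] in top degree yields a prime [p] and an invariant [xi]
    that is not divisible by [p] but orthogonal to the integral functionals.
    Multiplying it by a suitable [u] makes it orthogonal to the whole top
    degree part of [C], which [u] multiplies into the integral functionals. *)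
Lemma top_lattice_int (y : invdual d) : top_lattice C y -> invdualZ y.
Proof.
move=> yC; apply: contrapT => yZ.
have yfZ : invdualZ (y *+ d`!).
  by rewrite -scaler_nat; exact: (top_lattice_fact sub_CD).
have Tz := invdualZ_zmod B d.
have [p [m [p_pr ymZ ympZ]]] := zmod_set_torsion (fact_gt0 d) yfZ yZ.
have ymC : top_lattice C (y *+ m).
  exact: (zmod_setMz (top_lattice_zmod d C_zmod) (Posz m)).
have [S [smul [r [red [beta [bsym bassoc bnd]]]]]] := C_sym p_pr.
have [xi [xiZ xi_nd xi0]] :=
  bot_pair_degenerate C_zmod sub_DC beta p_pr red ymC ymZ ympZ.
have [u [uZ xiu_nd uS]] := C_faithful p_pr xiZ xi_nd.
have botC := bot_elt_mem sub_DC.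
apply: xiu_nd; apply: (bot_pair_nondeg C_zmod sub_DC sub_CD p_pr red
  bsym bassoc bnd); first exact: (imul_int C_mul sub_DC sub_CD).
move=> x xC; rewrite /bot_pair -mul_bot_bot.
rewrite (reduction_mul red (botC _ xiZ) (botC _ uZ)) bassoc.
rewrite -(reduction_mul red (botC _ uZ) xC) mul_bot_top; apply: xi0.
apply: (top_lattice_dpsym sub_CD (P := fun x => invdualZ (dactl u x))) xC => //.
split; first by rewrite (linear_map0 ((dactl_bilin B d).2 u)); exact: Tz.1.
move=> v w vZ wZ; rewrite (linear_mapB _ _ ((dactl_bilin B d).2 u)).
exact: Tz.2.
Qed.

(** The lowest component of an element of [C] is integral, because its products
    with elements of complementary degree have integral traces. *)
Lemma symmetric_order_sub : C `<=` turnerZ B d.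
Proof.
move=> z Cz e f; have zDP := sub_CD Cz; case: ifP => [/eqP|efd]; last first.
  by have := zDP e f; rewrite efd.
elim/ltn_ind: f e z Cz zDP => f IHf e z Cz zDP efd.
(* By induction the components with second degree below [f] form an element
   of the double; they may be removed from [z] without leaving [C]. *)
pose low : turner B := fun e' f' => if (f' < f)%N then z e' f' else 0.
have lowE e' f' : low e' f' = if (f' < f)%N then z e' f' else 0 by [].
have lowC : C low.
  apply: sub_DC => e' f'; rewrite lowE; case: (ltnP f' f) => f'f.
    case: eqP => [ef'|ne]; first by apply: IHf => //; exact/eqP.
    by have := zDP e' f'; case: eqP.
  by case: ifP => // _; exact: (lattice_tens_zmod _ _).1.
have zlE : (z - low) e f = z e f by rewrite turner_subE lowE ltnn subr0.
rewrite -zlE; apply: lattice_tens_pairing => eta y etaZ yZ.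
have wC : C (single (tensor eta y)).
  apply: sub_DC; apply: double_lattice_single; first by rewrite addnC.
  exact: lattice_tens_tensor.
have prodC := C_mul (C_zmod.2 _ _ Cz lowC) wC.
rewrite -top_part_mul_single; move: prodC.
set prod := turner_mul _ _ => prodC.
have d_eq : d = (f + e)%N by rewrite -efd addnC.
have prodE : prod = single (prod 0%N (f + e)%N).
  apply: single_of => b g; apply: turner_mul_lowest => e' f' /orP[f'f|ne].
    by rewrite turner_subE lowE f'f subrr.
  rewrite turner_subE lowE (_ : z e' f' = 0) ?if_same ?subrr //.
  by have := zDP e' f'; rewrite d_eq (negbTE ne).
have : top_lattice C (top_part (prod 0%N (f + e)%N) : Defs.invdual B (f + e)).
  by rewrite /top_lattice /top_elt /= top_partK -prodE.
move: (@inv1_int X B (f + e)); move: (top_part _); rewrite -d_eq => x i1Z xC.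
exact: (top_lattice_int xC).
Qed.

End Maximality.

(** * Matrix superalgebras *)

Section Matrices.
Variables (A : pzRingType) (B : superalg_basis A) (n d : nat).
Hypothesis le_dn : (d <= n)%N.
Local Notation MB := (mx_superalg_basis B n).

Lemma even_elt_delta (j k : 'I_n) : even_elt MB (delta_mx j k).
Proof.
move=> [[i l] b]; rewrite /= ffunE mxE /=; case: (_ && _) => /=.
  exact: (@even_elt1 A B b).
by rewrite bcoord0 ffunE eqxx.
Qed.

Lemma bcoord_bvec_delta (k l : bidx MB) (j c : 'I_n) :
  bcoord MB (bvec k * delta_mx j c) l =
  ((k.1.2 == j) && (l == (k.1.1, c, k.2)))%:R.
Proof.
case: k l => [[k1 k2] k3] [[l1 l2] l3]; rewrite /= ffunE /= mxE.
rewrite (bigD1 j) //= big1 ?addr0 => [|h hj]; last first.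
  by rewrite !mxE (negbTE hj) mulr0.
rewrite !mxE !xpair_eqE /= eqxx /= (eq_sym k2 j) (eq_sym l1 k1).
case: (l2 == c); rewrite ?andbF ?mulr0 ?mulr1 /=; last first.
  by rewrite bcoord0 ffunE.
rewrite (eq_sym k1) andbT.
case: (l1 == k1); case: (j == k2); rewrite ?bcoord0 ?ffunE //=.
by rewrite bcoord_bvec eq_sym.
Qed.

(** The symmetrization of these tensors replaces the columns [j] of a word by
    [1, ..., d], which are distinct; this needs [d <= n]. *)
Definition row_tens (j : 'I_d -> 'I_n) (a : 'I_d) : 'M[A]_n :=
  delta_mx (j a) (widen_ord le_dn a).

Lemma tmul_row_tens (x : tpow MB d) j (l : d.-tuple (bidx MB)) :
  tmul x (sym_ptens MB (row_tens j)) l = \sum_(g : 'S_d) \sum_s x s *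
    [forall a, ((tnth s a).1.2 == j (g a)) &&
      (tnth l a == ((tnth s a).1.1, widen_ord le_dn (g a), (tnth s a).2))]%:R.
Proof.
rewrite tmul_sym_ptens => [|a]; last exact: even_elt_delta.
do 2!apply: eq_bigr => ? _; congr (_ * _).
under eq_bigr do rewrite bcoord_bvec_delta.
case: forallP => [H|H]; first by rewrite big1 // => a _; rewrite H.
apply/eqP; apply: contra_notT H => /prodf_neq0 H a.
by move: (H a isT); case: (_ && _).
Qed.

(** The column indices of a word in the product are a rearrangement of
    [1, ..., d]. *)
Lemma row_tens_uniq (x : tpow MB d) j (l : d.-tuple (bidx MB)) :
  tmul x (sym_ptens MB (row_tens j)) l != 0 -> uniq l.
Proof.
rewrite tmul_row_tens => l0.
have [g gl] : exists g : 'S_d, forall a, (tnth l a).1.2 = widen_ord le_dn (g a).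
  apply: contrapT => no; case/eqP: l0.
  rewrite big1 // => g _; rewrite big1 // => s _.
  case: forallP => [H|_]; last by rewrite mulr0.
  by case: no; exists g => a; have /andP[_ /eqP ->] := H a.
apply/tuple_uniqP => a b ab; apply: (@perm_inj _ g); apply: val_inj.
by have := gl a; rewrite ab gl => /(congr1 val).
Qed.

(** The columns [1, ..., d] in this order only arise from the identity
    permutation, and from the word [s] alone. *)
Lemma row_tens_coef (x : tpow MB d) (s : d.-tuple (bidx MB)) :
  tmul x (sym_ptens MB (row_tens (fun a => (tnth s a).1.2)))
    [tuple ((tnth s a).1.1, widen_ord le_dn a, (tnth s a).2) | a < d] = x s.
Proof.
rewrite tmul_row_tens (bigD1 1%g) //= [X in _ + X]big1 ?addr0 => [|g g1].
  rewrite (bigD1 s) //= [X in _ + X]big1 ?addr0 => [|t ts].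
    case: forallP => [_|[]]; first by rewrite mulr1.
    by move=> a; rewrite perm1 tnth_mktuple !eqxx.
  case: forallP => [H|_]; last by rewrite mulr0.
  case/eqP: ts; apply: eq_from_tnth => a; have := H a.
  rewrite perm1 tnth_mktuple; case: (tnth t a) => [[t1 t2] t3] /=.
  case: (tnth s a) => [[s1 s2] s3] /= /andP[/eqP -> /eqP[-> ->]].
  by [].
rewrite big1 // => t _; case: forallP => [H|_]; last by rewrite mulr0.
case/eqP: g1; apply/permP => a; rewrite perm1; apply: val_inj.
have /andP[_] := H a; rewrite tnth_mktuple.
by move/eqP/(congr1 (fun l : bidx MB => val l.1.2)) => /= <-.
Qed.

Lemma matrix_faithful : faithful_dp MB d.
Proof.
move=> p xi p_pr xiZ xi_nd; have p0 : p%:R != 0 :> rat.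
  by rewrite pnatr_eq0 -lt0n prime_gt0.
have [s sp] : exists s, vsval xi s / p%:R \isn't a Num.int.
  apply: contrapT => no; apply: xi_nd; exists (p%:R^-1 *: xi).
    move=> s; rewrite linearZ_LR ffunE /GRing.scale /= mulrC.
    by apply: contrapT => sp; apply: no; exists s; exact/negP.
  by rewrite -scaler_nat scalerA mulfV // scale1r.
pose v := row_tens (fun a => (tnth s a).1.2).
have v_even a : even_elt MB (v a) by exact: even_elt_delta.
pose u : Defs.inv MB d := vsproj _ (sym_ptens MB v).
have uE : vsval u = sym_ptens MB v by rewrite vsprojK // sym_ptens_inv.
have uZ : invZ u by move=> t; rewrite uE sym_ptens_int.
have imulE eta : vsval (imul eta u) = tmul (vsval eta) (sym_ptens MB v).
  rewrite vsprojK uE //; apply: tmul_even_inv; first exact: sym_ptens_even.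
    exact: subvsP.
  exact: sym_ptens_inv.
exists u; split=> // [[eta etaZ xiuE]|y yS eta etaZ].
  case/negP: sp; rewrite -(row_tens_coef (vsval xi) s) -imulE xiuE.
  rewrite raddfMn /= -scaler_nat ffunE /GRing.scale /= mulrC mulKf //.
rewrite dactlE; apply: (dpsym_uniq_int yS); split=> [t|t]; rewrite imulE.
  by apply: tmul_int => // t'; rewrite sym_ptens_int.
exact: row_tens_uniq.
Qed.

End Matrices.

Theorem theorem2 (A : pzRingType) (B : superalg_basis A) (n d : nat)
    (n_gt0 : (1 <= n)%N) (le_dn : (d <= n)%N)
    (C : set (schur_ambient B n))
    (C_zmod : zmod_set C)
    (C_mul : forall x y, C x -> C y -> C (schur_mul B n x y))
    (sub_DC : schur_double B n d `<=` C)
    (sub_CD : C `<=` schur_double_dp B n d)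
    (C_sym : forall p : nat, prime p -> symmetric_mod (schur_mul B n) C p) :
  C = schur_double B n d.
Proof.
apply/seteqP; split=> //.
apply: (symmetric_order_sub C_zmod C_mul sub_DC sub_CD C_sym).
exact: matrix_faithful.
Qed.
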